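(* Let $k$ be a fixed positive integer. There is an $O(n^{k+2})$ time algorithm which, given a graph $G=(V,E)$ with $n$ vertices together with a model $(H,\psi)$ of $G$ such that $H$ has treewidth at most $k$, counts all independent sets in $G$.
   Context: All graphs are simple, finite and undirected. A model of a graph $G=(V,E)$ is a pair $(H,\psi)$ where $H=(\mathcal{V},\mathcal{E})$ is a graph and $\psi:V\to\mathcal{V}$ is a surjective function such that (1) for every $x\in\mathcal{V}$ the set $\psi^{-1}(x)$ is a clique in $G$, and (2) for every $uv\in E$ either $\psi(u)=\psi(v)$ or $\psi(u)\psi(v)\in\mathcal{E}$. *)

(* Defs.v *)
From mathcomp Require Import all_boot.

Set Implicit Arguments.
Unset Strict Implicit.
Unset Printing Implicit Defensive.

(** * Graphs *)

Record sgraph (V : finType) := SGraph {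
  adj :> rel V;
  adj_sym : symmetric adj;
  adj_irr : irreflexive adj
}.

Definition clique (V : finType) (G : sgraph V) (A : {set V}) : Prop :=
  {in A &, forall u v, u != v -> G u v}.

Definition independent (V : finType) (G : sgraph V) (A : {set V}) : bool :=
  [forall u in A, forall v in A, ~~ G u v].

Definition count_independent_sets (V : finType) (G : sgraph V) : nat :=
  #|[set A : {set V} | independent G A]|.

Definition is_model (V W : finType) (G : sgraph V) (H : sgraph W)
    (psi : V -> W) : Prop :=
  [/\ forall x, exists v, psi v = x,
      forall x, clique G (psi @^-1: [set x])
    & forall u v, G u v -> psi u = psi v \/ H (psi u) (psi v)].

Definition is_tree (N : finType) (T : sgraph N) : Prop :=
  [/\ 0 < #|N|,
      forall s t, connect T s t
    & forall c : seq N, 2 < size c -> ~ ucycle T c].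

(** The last field says that the nodes whose bags contain [v] induce a
    connected subgraph of the tree. *)
Record tree_decomposition (V : finType) (G : sgraph V) := TreeDecomposition {
  node : finType;
  tree : sgraph node;
  bag : node -> {set V};
  tree_is_tree : is_tree tree;
  bag_vertex : forall v, exists t, v \in bag t;
  bag_edge : forall u v, G u v -> exists t, (u \in bag t) && (v \in bag t);
  bag_connected : forall v s t, v \in bag s -> v \in bag t ->
    connect [rel a b | [&& tree a b, v \in bag a & v \in bag b]] s t
}.

(** The predecessor is truncated, so the decomposition of the empty graph with
    empty bags has width 0 instead of -1. *)
Definition width (V : finType) (G : sgraph V) (D : tree_decomposition G) : nat :=
  (\max_(t : node D) #|bag t|).-1.

Definition treewidth_at_most (V : finType) (G : sgraph V) (k : nat) : Prop :=
  exists D : tree_decomposition G, width D <= k.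

(** * Random access machine

    Programs are structured programs for a word RAM.  A state consists of
    registers and a random access memory, both holding words, and of a random
    access array of counters holding natural numbers of arbitrary size.  Words
    are the only values that can be tested or used as addresses, and every word
    computed must be smaller than a bound [W]; a program that overflows is
    stuck.  Counters hold the numbers of objects being counted, which are too
    large for a word: they can only be set to a constant, added and multiplied,
    each at unit cost.  As counters are never tested, subtracted, divided or
    converted to words, long integers cannot be used to speed up anything
    except the additions and multiplications of the counts themselves. *)

Record state := State {
  reg : nat -> nat;
  mem : nat -> nat;
  ctr : nat -> nat
}.

Inductive word_op := Add | Sub | Mul | Div | Mod.

Definition eval_op (o : word_op) : nat -> nat -> nat :=
  match o with
  | Add => addn | Sub => subn | Mul => muln | Div => divn | Mod => modn
  end.

Inductive test := Eq of nat & nat | Lt of nat & nat.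

Definition eval_test (b : test) (s : state) : bool :=
  match b with
  | Eq x y => reg s x == reg s y
  | Lt x y => reg s x < reg s y
  end.

(** All arguments of type [nat] are names of registers, except the constants
    [c] in [Const x c] and [CConst x c]. *)
Inductive cmd :=
  | Skip
  | Const (x c : nat)                   (* x := c *)
  | Op (o : word_op) (x y z : nat)      (* x := y o z *)
  | Read (x y : nat)                    (* x := mem[y] *)
  | Write (x y : nat)                   (* mem[x] := y *)
  | CConst (x c : nat)                  (* ctr[x] := c *)
  | CAdd (x y z : nat)                  (* ctr[x] := ctr[y] + ctr[z] *)
  | CMul (x y z : nat)                  (* ctr[x] := ctr[y] * ctr[z] *)
  | Seq (p q : cmd)
  | If (b : test) (p q : cmd)
  | While (b : test) (p : cmd).

Definition set_reg (s : state) (x v : nat) : state :=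
  State [eta reg s with x |-> v] (mem s) (ctr s).
Definition set_mem (s : state) (a v : nat) : state :=
  State (reg s) [eta mem s with a |-> v] (ctr s).
Definition set_ctr (s : state) (a v : nat) : state :=
  State (reg s) (mem s) [eta ctr s with a |-> v].

(** [exec W p s t s']: with word bound [W], the program [p] started in state
    [s] halts in state [s'] after exactly [t] steps, a step being the execution
    of one elementary instruction or the evaluation of one test. *)
Inductive exec (W : nat) : cmd -> state -> nat -> state -> Prop :=
  | exec_skip s : exec W Skip s 1 s
  | exec_const s x c : c < W -> exec W (Const x c) s 1 (set_reg s x c)
  | exec_op s o x y z : eval_op o (reg s y) (reg s z) < W ->
      exec W (Op o x y z) s 1 (set_reg s x (eval_op o (reg s y) (reg s z)))
  | exec_read s x y :
      exec W (Read x y) s 1 (set_reg s x (mem s (reg s y)))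
  | exec_write s x y :
      exec W (Write x y) s 1 (set_mem s (reg s x) (reg s y))
  | exec_cconst s x c :
      exec W (CConst x c) s 1 (set_ctr s (reg s x) c)
  | exec_cadd s x y z :
      exec W (CAdd x y z) s 1
        (set_ctr s (reg s x) (ctr s (reg s y) + ctr s (reg s z)))
  | exec_cmul s x y z :
      exec W (CMul x y z) s 1
        (set_ctr s (reg s x) (ctr s (reg s y) * ctr s (reg s z)))
  | exec_seq s1 s2 s3 p q t1 t2 : exec W p s1 t1 s2 -> exec W q s2 t2 s3 ->
      exec W (Seq p q) s1 (t1 + t2) s3
  | exec_if s s' b p q t : exec W (if eval_test b s then p else q) s t s' ->
      exec W (If b p q) s t.+1 s'
  | exec_while_false s b p : ~~ eval_test b s -> exec W (While b p) s 1 s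
  | exec_while_true s1 s2 s3 b p t1 t2 : eval_test b s1 ->
      exec W p s1 t1 s2 -> exec W (While b p) s2 t2 s3 ->
      exec W (While b p) s1 (t1 + t2).+1 s3.

(** Words of [O(log n)] bits, for inputs with [n] vertices. *)
Definition word_bound (b n : nat) : nat := (n + 2) ^ b.

(** The numbers of vertices of [G] and [H], the table of [psi], and the
    adjacency matrices of [G] and [H] in row-major order. *)
Definition encode (n m : nat) (G : sgraph 'I_n) (H : sgraph 'I_m)
    (psi : 'I_n -> 'I_m) : seq nat :=
  [:: n; m] ++ [seq val (psi u) | u <- enum 'I_n]
    ++ [seq nat_of_bool (G u v) | u <- enum 'I_n, v <- enum 'I_n]
    ++ [seq nat_of_bool (H x y) | x <- enum 'I_m, y <- enum 'I_m].

Definition init (input : seq nat) : state :=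
  State (fun _ => 0) (nth 0 input) (fun _ => 0).

Definition output (s : state) : nat := ctr s 0.

Definition bigO (f g : nat -> nat) : Prop :=
  exists c n0, forall n, n0 <= n -> f n <= c * g n.

(* Main.v *)
(* An independent set of [G] has at most one vertex in each clique [psi^-1 x].
   For a set [S] of at most [k] vertices of [H], a choice of at most one vertex
   of [G] above each element of [S], and a component [C] of [H - S], let
   [N(S, C)] be the number of independent sets of [G] above [C] that are
   compatible with the choice.  If [v] is in [C], then [N(S, C)] is the sum over
   the choices above [v] that are compatible with the given one of the product,
   over the components [C'] of [C - v], of [N(S', C')], where [S'] is any set of
   at most [k] elements of [S + v] that contains the neighbours of [C'].

   No tree decomposition is computed.  The entries [(S, C)] are treated by
   increasing size of [C], and every [v] in [C] is tried until each component
   of [C - v] has a suitable [S'] for which [N(S', C')] is already known.  If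
   the treewidth is at most [k], this succeeds whenever the neighbours of [C]
   lie in a bag: some such bag [B] meets [C], and any [v] in both will do, as
   the neighbours of each [C'] lie in [B] again and cannot be all of its [k+1]
   elements.  The empty [S] is therefore solved, and the answer is the product
   of the values [N(0, C)].

   A choice of one vertex of [H] with at most one vertex of [G] above it has at
   most [2n + 1] values, so there are [O(n^k)] pairs of a set [S] and a choice
   on it.  Their components are found in time [O(n^2)] for each pair, and each
   [v] is tried once for each pair, at a cost of [O(n)] for every choice above
   [v], which is again [O(n^2)] for all [v] together. *)

Require Import Defs.
From mathcomp Require Import all_boot zify.

Set Implicit Arguments.
Unset Strict Implicit.
Unset Printing Implicit Defensive.

(** * Connected sets and bags of a tree decomposition *)

(** Tables exist only for tuples of [k] digits, although a step looks at [S + v], which may have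
    [k + 1] elements; tables for those as well would cost another factor [n]. The way back is to
    delete one digit. That the deletion leaves the component of a vertex [y] unchanged is tested by
    comparing two stored labels, that of [y] and that of the deleted vertex, so no neighbourhood is
    computed and the test takes constant time. Correctness and success are proved apart. That a
    solved entry holds the right number ([sound]) needs no bound on the treewidth; the decomposition
    serves only to show that the search does not get stuck ([complete]). Tuples that name a vertex
    of [H] twice with conflicting options are processed like all others and merely excluded from
    [sound]. Words have [O(log n)] bits because each computed word is below a power of [n + 2] whose
    exponent is read off the program text. *)

Section Connect.
Variable T : finType.
Implicit Types e : rel T.

(** This is [connect_sub] with the extra knowledge that the edge to be replaced starts at a vertex
    reachable from [x]; it serves for edges that survive only inside one component. *)
Lemma connect_sub_from e e' x y :
  (forall a b, connect e x a -> e a b -> connect e' a b) ->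
  connect e x y -> connect e' x y.
Proof.
move=> ee' /connectP[p]; elim/last_ind: p y => [|p z IHp] y.
  by move=> _ ->; exact: connect0.
rewrite rcons_path last_rcons => /andP[pP ez] ->.
apply: connect_trans (IHp _ pP erefl) _; apply: ee' ez.
by apply/connectP; exists p.
Qed.

Lemma connect_invariant e (A : Type) (f : T -> A) x y :
  (forall a b, e a b -> f a = f b) -> connect e x y -> f x = f y.
Proof.
move=> ef /connectP[p]; elim: p x => [|z p IHp] x /=; first by move=> _ ->.
by move=> /andP[/ef-> /IHp IH] /IH.
Qed.

(** The edge [pq] is the first one of a path to enter [A]. The relation under [connect] records that
    the part before it stays outside [A], hence does not use that edge. *)
Lemma connect_exit e (A : {pred T}) x y :
  connect e x y -> x \notin A -> y \in A ->
  exists p q, [/\ connect [rel a b | [&& e a b, a \notin A & b \notin A]] x p,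
    p \notin A, e p q & q \in A].
Proof.
move=> /connectP[p]; elim: p x => [|z p IHp] x /=.
  by move=> _ -> /negPf->.
move=> /andP[exz pP] Dy xA yA; have [zA|zA] := boolP (z \in A).
  by exists x, z.
have [p' [q [c pA epq qA]]] := IHp _ pP Dy zA yA.
exists p', q; split=> //; apply: connect_trans c.
by apply: connect1; rewrite /= exz xA.
Qed.

Lemma tree_bridge (G : sgraph T) a b : is_tree G -> G a b ->
  ~~ connect [rel x y | G x y && ~~ [|| (x == a) && (y == b) | (x == b) && (y == a)]] a b.
Proof.
move=> [_ _ acyc] Gab; apply/negP=> /connectP[p].
case/shortenP=> p' pP uP _ Db.
have /= pG : path G a p' by apply: sub_path pP => x y /= /andP[].
apply: (acyc (a :: p')); last first.
  by rewrite /ucycle /cycle uP rcons_path pG -Db adj_sym Gab.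
(* A path without edges would make [a] its own neighbour, and one with a single edge would use the
   removed edge; so the cycle closed by [ab] has at least three nodes. *)
case: p' pP uP Db {pG} => [|y [|z p']] //=.
  by move=> _ _ Db; move: Gab; rewrite Db adj_irr.
by move=> + _ Db; rewrite -Db !eqxx /= andbF.
Qed.

End Connect.

Definition inside (V : finType) (G : sgraph V) (A : {set V}) : rel V :=
  [rel x y | [&& G x y, x \in A & y \in A]].

Definition nbh (V : finType) (G : sgraph V) (A : {set V}) : {set V} :=
  [set y | (y \notin A) && [exists x in A, G x y]].

Section TreeDecomposition.
Variables (V : finType) (G : sgraph V) (D : tree_decomposition G).
Implicit Types (A : {set V}) (t : node D).

(** A path in [A] is lifted to the tree: the nodes containing one vertex are connected, and each
    edge of the path lies in a common bag, where the walk passes from one vertex to the next. *)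
Lemma connected_bags A s t : {in A &, forall x y, connect (inside G A) x y} ->
  [exists x in A, x \in bag s] -> [exists x in A, x \in bag t] ->
  connect [rel a b | [&& tree D a b, [exists x in A, x \in bag a]
                       & [exists x in A, x \in bag b]]] s t.
Proof.
move=> cA /exists_inP[x xA xs] /exists_inP[y yA yt].
have same z u w : z \in A -> z \in bag u -> z \in bag w ->
    connect [rel a b | [&& tree D a b, [exists x in A, x \in bag a]
                       & [exists x in A, x \in bag b]]] u w.
  move=> zA zu zw; apply: connect_sub (bag_connected zu zw) => a b /= /and3P[ab za zb].
  by apply: connect1; rewrite /= ab /=; apply/andP; split; apply/exists_inP; exists z.
have /connectP[p] := cA x y xA yA; elim: p x s xA xs => [|z p IHp] x s xA xs /=.
  by move=> _ Dx; rewrite -Dx in xs; exact: same yt.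
move=> /andP[/and3P[xz _ zA] pP] Dy.
have [w /andP[xw zw]] := bag_edge D xz.
exact: connect_trans (same x _ _ xA xs xw) (IHp z w zA zw pP Dy).
Qed.

(* Otherwise let [pq] be the edge by which a path from [t] first enters the
   nodes whose bags meet [A].  If [q] missed a neighbour [y] of [A], then the
   nodes containing [y] would join [p] to [q] without using this edge. *)
Lemma bag_meeting A t : A != set0 ->
  {in A &, forall x y, connect (inside G A) x y} ->
  nbh G A \subset bag t ->
  exists2 t' : node D, nbh G A \subset bag t' & [exists x in A, x \in bag t'].
Proof.
move=> /set0Pn[x0 x0A] cA nAt.
pose TA := [pred s : node D | [exists x in A, x \in bag s]].
have [|tA] := boolP (t \in TA); first by exists t.
have [s0 x0s] := bag_vertex D x0.
have s0A : s0 \in TA by apply/exists_inP; exists x0.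
have [p [q [ctp pA epq qA]]] :=
  connect_exit (let: And3 _ c _ := tree_is_tree D in c t s0) tA s0A.
exists q => //; apply/subsetP=> y yn; have yt := subsetP nAt y yn.
apply: contraT => yq; exfalso.
move: yn; rewrite inE => /andP[_ /exists_inP[x xA xy]].
have [w /andP[xw yw]] := bag_edge D xy.
have wA : w \in TA by apply/exists_inP; exists x.
apply: (negP (tree_bridge (tree_is_tree D) epq)).
set e := (X in connect X).
have symE : connect_sym e.
  apply: sym_connect_sym => a b /=.
  rewrite /e /= adj_sym orbC; congr (_ && ~~ (_ || _)); exact: andbC.
have c1 : connect e t p.
  apply: connect_sub ctp => a b /= /and3P[ab aA bA]; apply: connect1.
  rewrite /e /= ab /=; apply/norP; split; apply/negP=> /andP[/eqP aE /eqP bE].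
    by rewrite bE qA in bA.
  by rewrite aE qA in aA.
have c2 : connect e t w.
  apply: connect_sub (bag_connected yt yw) => a b /= /and3P[ab ya yb].
  apply: connect1; rewrite /e /= ab /=; apply/norP; split;
    apply/negP=> /andP[/eqP aE /eqP bE].
    by rewrite bE (negPf yq) in yb.
  by rewrite aE (negPf yq) in ya.
have c3 : connect e w q.
  apply: connect_sub (connected_bags cA wA qA) => a b /= /and3P[ab aA bA].
  apply: connect1; rewrite /e /= ab /=; apply/norP; split;
    apply/negP=> /andP[/eqP aE /eqP bE].
    by move: pA; rewrite -aE inE /= aA.
  by move: pA; rewrite -bE inE /= bA.
by rewrite symE in c1; exact: connect_trans c1 (connect_trans c2 c3).
Qed.

End TreeDecomposition.

(** * A language with bounded loops and its compilation *)

(** Expressions have no side effects and a cost bound that does not depend on the state, so running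
    times are governed by the loop bounds and the branches taken. *)
Inductive expr :=
  | Var (x : nat)
  | Cst (c : nat)
  | Bin (o : word_op) (a b : expr)
  | Eqb (a b : expr)
  | Ltb (a b : expr)
  | Mem (a : expr)
  | Cond (c a b : expr).

(* Variables are immutable: only the memory and the counters change. *)
Inductive stmt :=
  | Nop
  | Store (a b : expr)
  | CSet (a : expr) (c : nat)
  | CPlus (a b c : expr)
  | CTimes (a b c : expr)
  | Sq (p q : stmt)
  | Ite (c : expr) (p q : stmt)
  | For (x : nat) (e : expr) (p : stmt)
  | Let (x : nat) (e : expr) (p : stmt).

Definition upd (f : nat -> nat) (x v : nat) : nat -> nat :=
  fun y => if y == x then v else f y.
Arguments upd f x v y /.

Definition mset (M : nat -> nat) (a v : nat) : nat -> nat := [eta M with a |-> v].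

Fixpoint eval (r M : nat -> nat) (e : expr) : nat :=
  match e with
  | Var x => r x
  | Cst c => c
  | Bin o a b => eval_op o (eval r M a) (eval r M b)
  | Eqb a b => eval r M a == eval r M b
  | Ltb a b => eval r M a < eval r M b
  | Mem a => M (eval r M a)
  | Cond c a b => if 0 < eval r M c then eval r M a else eval r M b
  end.

(* The values of variables and expressions are kept in the registers from [d]
   on; [u] maps each variable in scope to its register. *)
Fixpoint compile_expr (u : nat -> nat) (d : nat) (e : expr) : cmd :=
  match e with
  | Var x => Seq (Const d 0) (Op Add d (u x) d)
  | Cst c => Const d c
  | Bin o a b =>
      Seq (compile_expr u d a)
        (Seq (compile_expr u d.+1 b) (Op o d d d.+1))
  | Eqb a b =>
      Seq (compile_expr u d a)
        (Seq (compile_expr u d.+1 b) (If (Eq d d.+1) (Const d 1) (Const d 0)))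
  | Ltb a b =>
      Seq (compile_expr u d a)
        (Seq (compile_expr u d.+1 b) (If (Lt d d.+1) (Const d 1) (Const d 0)))
  | Mem a => Seq (compile_expr u d a) (Read d d)
  | Cond c a b =>
      Seq (compile_expr u d c) (Seq (Const d.+1 0)
        (If (Lt d.+1 d) (compile_expr u d a) (compile_expr u d b)))
  end.

(** A loop keeps its bound in register [d] and its counter in [d.+1], both below the registers that
    the body may write. The bound is thus evaluated once, and every loop terminates. *)
Fixpoint compile (u : nat -> nat) (d : nat) (p : stmt) : cmd :=
  match p with
  | Nop => Skip
  | Store a b =>
      Seq (compile_expr u d a) (Seq (compile_expr u d.+1 b) (Write d d.+1))
  | CSet a c => Seq (compile_expr u d a) (CConst d c)
  | CPlus a b c =>
      Seq (compile_expr u d a) (Seq (compile_expr u d.+1 b)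
        (Seq (compile_expr u d.+2 c) (CAdd d d.+1 d.+2)))
  | CTimes a b c =>
      Seq (compile_expr u d a) (Seq (compile_expr u d.+1 b)
        (Seq (compile_expr u d.+2 c) (CMul d d.+1 d.+2)))
  | Sq p q => Seq (compile u d p) (compile u d q)
  | Ite c p q =>
      Seq (compile_expr u d c) (Seq (Const d.+1 0)
        (If (Lt d.+1 d) (compile u d p) (compile u d q)))
  | For x e p =>
      Seq (compile_expr u d e) (Seq (Const d.+1 0)
        (While (Lt d.+1 d) (Seq (compile (upd u x d.+1) d.+2 p)
          (Seq (Const d.+2 1) (Op Add d.+1 d.+1 d.+2)))))
  | Let x e p => Seq (compile_expr u d e) (compile (upd u x d) d.+1 p)
  end.

Fixpoint ecost (e : expr) : nat :=
  match e with
  | Var _ => 2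
  | Cst _ => 1
  | Bin _ a b => ecost a + ecost b + 1
  | Eqb a b | Ltb a b => ecost a + ecost b + 2
  | Mem a => ecost a + 1
  | Cond c a b => ecost c + 2 + (ecost a + ecost b)
  end.

(* Only meaningful for statements without loops. *)
Fixpoint scost (p : stmt) : nat :=
  match p with
  | Nop => 1
  | Store a b => ecost a + ecost b + 1
  | CSet a _ => ecost a + 1
  | CPlus a b c | CTimes a b c => ecost a + ecost b + ecost c + 1
  | Sq p q => scost p + scost q
  | Ite c p q => ecost c + 2 + (scost p + scost q)
  | For _ _ _ => 0
  | Let _ e p => ecost e + scost p
  end.

(* If [r x < X ^ g x] for every variable [x] and all memory words are smaller
   than [X], then [e] and its subexpressions are smaller than [X ^ edeg g e]. *)
Fixpoint edeg (g : nat -> nat) (e : expr) : nat :=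
  match e with
  | Var x => (g x).+1
  | Cst c => c.+1
  | Bin _ a b => (edeg g a + edeg g b).+1
  | Eqb a b | Ltb a b => (edeg g a + edeg g b).+1
  | Mem a => (edeg g a).+1
  | Cond c a b => (edeg g c + edeg g a + edeg g b).+1
  end.

(** Degrees are added rather than maximised, so that a bound on the whole passes to each part by
    linear arithmetic. A loop variable stays below its bound and inherits the degree of the
    bound. *)
Fixpoint sdeg (g : nat -> nat) (p : stmt) : nat :=
  match p with
  | Nop => 1
  | Store a b => edeg g a + edeg g b
  | CSet a _ => edeg g a
  | CPlus a b c | CTimes a b c => edeg g a + edeg g b + edeg g c
  | Sq p q => sdeg g p + sdeg g q
  | Ite c p q => edeg g c + sdeg g p + sdeg g q
  | For x e p | Let x e p => edeg g e + sdeg (upd g x (edeg g e)) p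
  end.

Lemma edeg_gt0 g e : 0 < edeg g e.
Proof. by case: e. Qed.

Section Hoare.
Variables (X D W : nat).
Hypotheses (X_gt1 : 1 < X) (leW : X ^ D <= W).

Lemma leX a b : a <= b -> X ^ a <= X ^ b.
Proof. by move=> ab; rewrite leq_exp2l. Qed.

Lemma ltX_le v a b : v < X ^ a -> a <= b -> v < X ^ b.
Proof. by move=> va ab; apply: leq_trans va (leX ab). Qed.

(** The successor in the exponent is for addition: [X ^ a + X ^ b] is at most [2 * X ^ (a + b)], and
    [2 <= X]. Products need only [a + b], and the other operations do not exceed their first
    argument. *)
Lemma eval_op_lt o x y a b : x < X ^ a -> y < X ^ b ->
  eval_op o x y < X ^ (a + b).+1.
Proof.
move=> xa yb.
have X0 c : 0 < X ^ c by rewrite expn_gt0 (ltnW X_gt1).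
have le_x z : z <= x -> z < X ^ (a + b).+1.
  by move=> zx; apply: ltX_le (leq_ltn_trans zx xa) _; lia.
case: o => /=.
- apply: (@leq_trans (2 * X ^ (a + b))); last by rewrite expnS leq_mul2r X_gt1 orbT.
  have := leX (leq_addr b a); have := leX (leq_addl a b); lia.
- by apply: le_x; rewrite leq_subr.
- apply: (@leq_trans (X ^ a * X ^ b)); first exact: ltn_mul.
  by rewrite -expnD leX.
- by apply: le_x; apply: leq_div.
- by apply: le_x; apply: leq_mod.
Qed.

Section Expr.
Variables (r M g : nat -> nat).
Hypotheses (rg : forall x, r x < X ^ g x) (MX : forall a, M a < X).

Lemma eval_lt e : eval r M e < X ^ edeg g e.
Proof.
have lt1 (b : bool) c : b < X ^ c.+1.
  by apply: (@leq_trans (X ^ 1)); [case: b; lia | apply: leX].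
elim: e => [x|c|o a IHa b IHb|a _ b _|a _ b _|a _|c _ a IHa b IHb] /=.
- exact: ltX_le (rg x) _.
- by apply: leq_trans (ltn_expl c X_gt1) _; apply: leX.
- exact: eval_op_lt.
- exact: lt1.
- exact: lt1.
- by apply: leq_trans (MX _) _; rewrite -[leqLHS]expn1 leX.
- by case: ifP => _; [apply: ltX_le IHa _ | apply: ltX_le IHb _]; lia.
Qed.

Lemma compile_exprP u e d s : edeg g e <= D ->
  (forall x, u x < d) -> (forall x, reg s (u x) = r x) -> Defs.mem s = M ->
  exists t s', [/\ exec W (compile_expr u d e) s t s', t <= ecost e,
    reg s' d = eval r M e, (forall x, x < d -> reg s' x = reg s x)
    & Defs.mem s' = M /\ ctr s' = ctr s].
Proof.
have W_gt1 c : 0 < c -> c <= D -> 1 < W.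
  move=> c0 cD; apply: leq_trans leW; apply: leq_trans X_gt1 _.
  by rewrite -[leqLHS]expn1 leX //; lia.
have W_lt v c : v < X ^ c -> c <= D -> v < W.
  by move=> vc cD; apply: leq_trans leW; apply: ltX_le vc cD.
have frame d0 s0 s1 : (forall x, x < d0 -> reg s1 x = reg s0 x) ->
    (forall x, u x < d0) -> (forall x, reg s0 (u x) = r x) ->
    forall x, reg s1 (u x) = r x.
  by move=> e01 ud us x; rewrite e01.
elim: e d s => [x|c|o a IHa b IHb|a IHa b IHb|a IHa b IHb|a IHa|c IHc a IHa b IHb] d s /=
  degD ud us sM.
- have neq : (u x == d) = false by apply/negbTE; have := ud x; lia.
  exists (1 + 1), (set_reg (set_reg s d 0) d (r x)); split=> //.
  + apply: exec_seq; first by apply: exec_const; apply: (W_lt _ 1); lia.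
    have /= := @exec_op W (set_reg s d 0) Add d (u x) d.
    rewrite /= eqxx neq us addn0; apply.
    by apply: W_lt (rg x) _; lia.
  + by rewrite /= eqxx.
  + by move=> y yd; rewrite /= !ifN //; lia.
- exists 1, (set_reg s d c); split=> //.
  + by apply: exec_const; apply: W_lt (ltn_expl c X_gt1) _; lia.
  + by rewrite /= eqxx.
  + by move=> y yd; rewrite /= ifN //; lia.
- have [|t1 [s1 [x1 c1 v1 f1 [m1 k1]]]] := IHa d s _ ud us sM; first lia.
  have [||t2 [s2 [x2 c2 v2 f2 [m2 k2]]]] := IHb d.+1 s1 _ _ (frame _ _ _ f1 ud us) m1.
  + lia.
  + by move=> x; have := ud x; lia.
  have v1' : reg s2 d = eval r M a by rewrite f2.
  exists (t1 + (t2 + 1)), (set_reg s2 d (eval_op o (reg s2 d) (reg s2 d.+1))).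
  split; last by rewrite k2 k1.
  + apply: exec_seq x1 _; apply: exec_seq x2 _; apply: exec_op.
    by rewrite v1' v2; apply: W_lt (eval_lt (Bin o a b)) _.
  + lia.
  + by rewrite /= eqxx v1' v2.
  + by move=> y yd; rewrite /= ifN ?f2 ?f1 //; lia.
- have [|t1 [s1 [x1 c1 v1 f1 [m1 k1]]]] := IHa d s _ ud us sM; first lia.
  have [||t2 [s2 [x2 c2 v2 f2 [m2 k2]]]] := IHb d.+1 s1 _ _ (frame _ _ _ f1 ud us) m1.
  + lia.
  + by move=> x; have := ud x; lia.
  have v1' : reg s2 d = eval r M a by rewrite f2.
  exists (t1 + (t2 + 1.+1)), (set_reg s2 d (eval r M a == eval r M b)).
  split; last by rewrite k2 k1.
  + apply: exec_seq x1 _; apply: exec_seq x2 _; apply: exec_if.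
    rewrite /= v1' v2; case: eqP => _; apply: exec_const.
      by apply: (W_gt1 1); lia.
    by apply: ltnW; apply: (W_gt1 1); lia.
  + lia.
  + by rewrite /= eqxx.
  + by move=> y yd; rewrite /= ifN ?f2 ?f1 //; lia.
- have [|t1 [s1 [x1 c1 v1 f1 [m1 k1]]]] := IHa d s _ ud us sM; first lia.
  have [||t2 [s2 [x2 c2 v2 f2 [m2 k2]]]] := IHb d.+1 s1 _ _ (frame _ _ _ f1 ud us) m1.
  + lia.
  + by move=> x; have := ud x; lia.
  have v1' : reg s2 d = eval r M a by rewrite f2.
  exists (t1 + (t2 + 1.+1)), (set_reg s2 d (eval r M a < eval r M b)).
  split; last by rewrite k2 k1.
  + apply: exec_seq x1 _; apply: exec_seq x2 _; apply: exec_if.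
    rewrite /= v1' v2; case: ltnP => _; apply: exec_const.
      by apply: (W_gt1 1); lia.
    by apply: ltnW; apply: (W_gt1 1); lia.
  + lia.
  + by rewrite /= eqxx.
  + by move=> y yd; rewrite /= ifN ?f2 ?f1 //; lia.
- have [|t1 [s1 [x1 c1 v1 f1 [m1 k1]]]] := IHa d s _ ud us sM; first lia.
  exists (t1 + 1), (set_reg s1 d (Defs.mem s1 (reg s1 d))); split=> //.
  + by apply: exec_seq x1 _; apply: exec_read.
  + lia.
  + by rewrite /= eqxx v1 m1.
  + by move=> y yd; rewrite /= ifN ?f1 //; lia.
- have [|t1 [s1 [x1 c1 v1 f1 [m1 k1]]]] := IHc d s _ ud us sM; first lia.
  pose s2 := set_reg s1 d.+1 0.
  have f2 y : y < d -> reg s2 y = reg s y by move=> yd; rewrite /= ifN ?f1 //; lia.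
  have test : eval_test (Lt d.+1 d) s2 = (0 < eval r M c).
    by rewrite /= eqxx ifN ?v1 //; lia.
  have [t3 [s3 [x3 c3 v3 f3 [m3 k3]]]] : exists t s', [/\ exec W
      (if 0 < eval r M c then compile_expr u d a else compile_expr u d b) s2 t s',
      t <= ecost a + ecost b,
      reg s' d = (if 0 < eval r M c then eval r M a else eval r M b),
      (forall x, x < d -> reg s' x = reg s2 x) & Defs.mem s' = M /\ ctr s' = ctr s2].
    case: ifP => _.
      have [|t3 [s3 [x3 c3 v3 f3 m3]]] := IHa d s2 _ ud (frame _ _ _ f2 ud us) m1.
        lia.
      by exists t3, s3; split=> //; lia.
    have [|t3 [s3 [x3 c3 v3 f3 m3]]] := IHb d s2 _ ud (frame _ _ _ f2 ud us) m1.
      lia.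
    by exists t3, s3; split=> //; lia.
  exists (t1 + (1 + t3.+1)), s3; split=> //; last by rewrite k3.
  + apply: exec_seq x1 _; apply: (@exec_seq _ _ s2).
      by apply: exec_const; apply: (W_lt _ 1); lia.
    by apply: exec_if; rewrite test.
  + lia.
  + by move=> y yd; rewrite f3 ?f2.
Qed.

End Expr.

(* [post p r M C c Q]: from variables [r], memory [M] and counters [C], the code
   compiled from [p] runs without overflow for at most [c] steps, keeps all memory
   words below [X] and ends in a memory and counters that satisfy [Q].  As [X ^ D]
   bounds all words that a statement of degree [D] can compute, only the words that
   are stored have to be bounded by hand. *)
Definition post (p : stmt) (r M C : nat -> nat) (c : nat)
    (Q : (nat -> nat) -> (nat -> nat) -> Prop) : Prop :=
  forall g u d s, sdeg g p <= D -> (forall x, r x < X ^ g x) ->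
    (forall x, u x < d) -> (forall x, reg s (u x) = r x) ->
    Defs.mem s = M -> ctr s = C -> (forall a, M a < X) ->
  exists t s', [/\ exec W (compile u d p) s t s', t <= c,
    (forall x, x < d -> reg s' x = reg s x), (forall a, Defs.mem s' a < X)
    & Q (Defs.mem s') (ctr s')].

Implicit Types (p q : stmt) (r M C : nat -> nat).
Implicit Types (Q R : (nat -> nat) -> (nat -> nat) -> Prop).

Lemma post_weaken p r M C c c' Q Q' : c <= c' ->
  (forall M' C', Q M' C' -> Q' M' C') -> post p r M C c Q -> post p r M C c' Q'.
Proof.
move=> cc' QQ' P g u d s gD rg ud us sM sC MX.
have [t [s' [x le_t f b q]]] := P g u d s gD rg ud us sM sC MX.
by exists t, s'; split=> //; [apply: leq_trans cc' | apply: QQ'].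
Qed.

Lemma post_nop r M C Q : Q M C -> post Nop r M C 1 Q.
Proof.
move=> q g u d s _ _ _ _ sM sC MX; exists 1, s; split=> //.
- exact: exec_skip.
- by move=> a; rewrite sM.
- by rewrite sM sC.
Qed.

Lemma post_seq p q r M C c c' R Q : post p r M C c R ->
  (forall M' C', R M' C' -> post q r M' C' c' Q) ->
  post (Sq p q) r M C (c + c') Q.
Proof.
move=> Pp Pq g u d s /= gD rg ud us sM sC MX.
have [|t [s1 [x1 le1 f1 b1 q1]]] := Pp g u d s _ rg ud us sM sC MX; first lia.
have [||t2 [s2 [x2 le2 f2 b2 q2]]] :=
  Pq _ _ q1 g u d s1 _ rg ud _ erefl erefl b1; first lia.
  by move=> x; rewrite f1.
exists (t + t2), s2; split=> //.
- exact: exec_seq x1 x2.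
- exact: leq_add.
- by move=> x xd; rewrite f2 ?f1.
Qed.

Lemma compile_expr_run r M g u e d s : edeg g e <= D -> (forall x, r x < X ^ g x) ->
  (forall a, M a < X) -> (forall x, u x < d) -> (forall x, reg s (u x) = r x) ->
  Defs.mem s = M ->
  exists t s', [/\ exec W (compile_expr u d e) s t s', t <= ecost e,
    reg s' d = eval r M e, (forall x, x < d -> reg s' x = reg s x)
    & [/\ Defs.mem s' = M, ctr s' = ctr s & forall x, reg s' (u x) = r x]].
Proof.
move=> gD rg MX ud us sM.
have [t [s' [x c v f [m k]]]] := compile_exprP rg MX gD ud us sM.
by exists t, s'; split=> //; split=> // y; rewrite f.
Qed.

Lemma post_store a b r M C Q : eval r M b < X ->
  Q (mset M (eval r M a) (eval r M b)) C ->
  post (Store a b) r M C (scost (Store a b)) Q.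
Proof.
move=> bX q g u d s /= gD rg ud us sM sC MX.
have [|t1 [s1 [x1 c1 v1 f1 [m1 k1 us1]]]] := compile_expr_run (e := a) _ rg MX ud us sM.
  by apply: leq_trans gD; rewrite leq_addr.
have [||t2 [s2 [x2 c2 v2 f2 [m2 k2 _]]]] := compile_expr_run (e := b) (d := d.+1) _ rg MX _
  us1 m1.
- by apply: leq_trans gD; rewrite leq_addl.
- by move=> x; have := ud x; lia.
exists (t1 + (t2 + 1)), (set_mem s2 (reg s2 d) (reg s2 d.+1)); split=> //=.
- by apply: exec_seq x1 _; apply: exec_seq x2 _; apply: exec_write.
- lia.
- by move=> x xd; rewrite f2 ?f1 //; lia.
- by move=> y; rewrite v2 m2; case: ifP.
- by rewrite f2 // v1 v2 m2 k2 k1 sC.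
Qed.

Lemma post_cset a c r M C Q : Q M (mset C (eval r M a) c) ->
  post (CSet a c) r M C (scost (CSet a c)) Q.
Proof.
move=> q g u d s /= gD rg ud us sM sC MX.
have [|t1 [s1 [x1 c1 v1 f1 [m1 k1 us1]]]] := compile_expr_run (e := a) _ rg MX ud us sM =>
  //.
exists (t1 + 1), (set_ctr s1 (reg s1 d) c); split=> //=.
- by apply: exec_seq x1 _; apply: exec_cconst.
- lia.
- by rewrite m1.
- by rewrite v1 m1 k1 sC.
Qed.

Lemma post_cop (f : bool) a b c r M C Q :
  let h := if f then addn else muln in let p := if f then CPlus else CTimes in
  Q M (mset C (eval r M a) (h (C (eval r M b)) (C (eval r M c)))) ->
  post (p a b c) r M C (scost (p a b c)) Q.
Proof.
move=> h p q g u d s /= gD rg ud us sM sC MX.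
have {}gD : edeg g a + edeg g b + edeg g c <= D by move: gD; rewrite /p; case: (f).
have [|t1 [s1 [x1 c1 v1 f1 [m1 k1 us1]]]] := compile_expr_run (e := a) _ rg MX ud us sM.
  lia.
have [||t2 [s2 [x2 c2 v2 f2 [m2 k2 us2]]]] :=
  compile_expr_run (d := d.+1) (e := b) _ rg MX _ us1 m1; first lia.
  by move=> x; have := ud x; lia.
have [||t3 [s3 [x3 c3 v3 f3 [m3 k3 _]]]] :=
  compile_expr_run (d := d.+2) (e := c) _ rg MX _ us2 m2; first lia.
  by move=> x; have := ud x; lia.
exists (t1 + (t2 + (t3 + 1))), (set_ctr s3 (reg s3 d)
   (h (ctr s3 (reg s3 d.+1)) (ctr s3 (reg s3 d.+2)))); split=> //=.
- rewrite /p /h; case: (f) => /=.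
    apply: exec_seq x1 _; apply: exec_seq x2 _; apply: exec_seq x3 _; exact: exec_cadd.
  apply: exec_seq x1 _; apply: exec_seq x2 _; apply: exec_seq x3 _; exact: exec_cmul.
- rewrite /p; case: (f) => /=; lia.
- by move=> x xd; rewrite f3 ?f2 ?f1 //; lia.
- by rewrite m3.
- by rewrite v3 !f3 // v2 f2 // v1 m3 k3 k2 k1 sC.
Qed.

Lemma post_cplus a b c r M C Q :
  Q M (mset C (eval r M a) (C (eval r M b) + C (eval r M c))) ->
  post (CPlus a b c) r M C (scost (CPlus a b c)) Q.
Proof. exact: (@post_cop true). Qed.

Lemma post_ctimes a b c r M C Q :
  Q M (mset C (eval r M a) (C (eval r M b) * C (eval r M c))) ->
  post (CTimes a b c) r M C (scost (CTimes a b c)) Q.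
Proof. exact: (@post_cop false). Qed.

(** Only the branch taken is paid for. The time bound of the search depends on this: most pairs and
    most options are discarded by a test before the expensive branch. *)
Lemma post_ite c p q r M C k1 k2 Q :
  (0 < eval r M c -> post p r M C k1 Q) ->
  (eval r M c = 0 -> post q r M C k2 Q) ->
  post (Ite c p q) r M C
    (ecost c + 2 + (if 0 < eval r M c then k1 else k2)) Q.
Proof.
move=> Pp Pq g u d s /= gD rg ud us sM sC MX.
have [|t1 [s1 [x1 c1 v1 f1 [m1 kk1 us1]]]] := compile_expr_run (e := c) _ rg MX ud us sM.
  lia.
pose s2 := set_reg s1 d.+1 0.
have W_gt0 : 0 < W.
  by apply: leq_trans leW; rewrite expn_gt0 ltnW.
have us2 x : reg s2 (u x) = r x.
  by rewrite /= ifN ?us1 //; have := ud x; lia.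
have test : eval_test (Lt d.+1 d) s2 = (0 < eval r M c).
  by rewrite /= eqxx ifN ?v1 //; lia.
have [t3 [s3 [x3 le3 f3 b3 q3]]] : exists t s', [/\ exec W
    (if 0 < eval r M c then compile u d p else compile u d q) s2 t s',
    t <= (if 0 < eval r M c then k1 else k2),
    (forall x, x < d -> reg s' x = reg s2 x),
    (forall a, Defs.mem s' a < X) & Q (Defs.mem s') (ctr s')].
  case: ltnP => cv.
    apply: (Pp cv g u d s2) => //; [lia | by rewrite /= kk1].
  apply: (Pq _ g u d s2) => //; [lia | lia | by rewrite /= kk1].
exists (t1 + (1 + t3.+1)), s3; split=> //; last first.
- move=> x xd; rewrite f3 //= ifN ?f1 //; lia.
- lia.
apply: exec_seq x1 _; apply: (@exec_seq _ _ s2); first exact: exec_const.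
by apply: exec_if; rewrite test.
Qed.

(** The coarser bound that agrees with [scost], for places where both branches are cheap. *)
Lemma post_ite_sum c p q r M C k1 k2 Q :
  (0 < eval r M c -> post p r M C k1 Q) ->
  (eval r M c = 0 -> post q r M C k2 Q) ->
  post (Ite c p q) r M C (ecost c + 2 + (k1 + k2)) Q.
Proof.
move=> Pp Pq; apply: post_weaken (post_ite Pp Pq) => //.
by rewrite leq_add2l; case: ifP; rewrite ?leq_addr ?leq_addl.
Qed.

Lemma post_let x e p r M C c Q :
  post p (upd r x (eval r M e)) M C c Q ->
  post (Let x e p) r M C (ecost e + c) Q.
Proof.
move=> P g u d s /= gD rg ud us sM sC MX.
have [|t1 [s1 [x1 c1 v1 f1 [m1 k1 us1]]]] := compile_expr_run (e := e) _ rg MX ud us sM.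
  lia.
have [|||||t2 [s2 [x2 c2 f2 b2 q2]]] :=
  P (upd g x (edeg g e)) (upd u x d) d.+1 s1 _ _ _ _ m1 _ MX.
- lia.
- by move=> y /=; case: ifP => _ //; apply: eval_lt.
- by move=> y /=; case: ifP => _ //; have := ud y; lia.
- by move=> y /=; case: ifP => _; rewrite ?us1.
- by rewrite k1.
exists (t1 + t2), s2; split=> //.
- exact: exec_seq x1 x2.
- lia.
- by move=> y yd; rewrite f2 ?f1 //; lia.
Qed.

(** The 2 pays for clearing the counter and for the last, failing test; the 3 pays for a successful
    test and the two instructions that increment the counter. *)
Lemma post_for x e p r M C (I : nat -> (nat -> nat) -> (nat -> nat) -> Prop)
    (c : nat -> nat) Q :
  I 0 M C ->
  (forall j M' C', j < eval r M e -> I j M' C' ->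
     post p (upd r x j) M' C' (c j) (I j.+1)) ->
  (forall M' C', I (eval r M e) M' C' -> Q M' C') ->
  post (For x e p) r M C (ecost e + 2 + \sum_(j < eval r M e) (c j + 3)) Q.
Proof.
move=> I0 Ip IQ g u d s /= gD rg ud us sM sC MX.
have [|t1 [s1 [x1 c1 v1 f1 [m1 k1 us1]]]] := compile_expr_run (e := e) _ rg MX ud us sM.
  lia.
set N := eval r M e in I0 Ip IQ v1 *.
have W_gt1 : 1 < W.
  have := edeg_gt0 g e => e0; apply: leq_trans leW; apply: leq_trans X_gt1 _.
  by rewrite -[leqLHS]expn1 leX //; lia.
have NX : N < X ^ edeg g e by apply: eval_lt.
have NW : N < W by apply: leq_trans leW; apply: ltX_le NX _; lia.
set body := Seq (compile _ _ p) _.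
(* Induction on the number [i] of iterations left; the body is compiled from [d.+2] on and leaves
   the bound and the counter alone. *)
have loop i j s0 : i + j = N -> I j (Defs.mem s0) (ctr s0) -> reg s0 d = N ->
    reg s0 d.+1 = j -> (forall x, x < d -> reg s0 x = reg s x) ->
    (forall a, Defs.mem s0 a < X) ->
    exists t s', [/\ exec W (While (Lt d.+1 d) body) s0 t s',
      t <= 1 + \sum_(j <= l < N) (c l + 3), (forall x, x < d -> reg s' x = reg s x),
      (forall a, Defs.mem s' a < X) & I N (Defs.mem s') (ctr s')].
  elim: i j s0 => [|i IHi] j s0 ijN Ij dN dj f0 b0.
    rewrite add0n in ijN; exists 1, s0; split=> //; last by rewrite -ijN.
    by apply: exec_while_false; rewrite /= dN dj ijN ltnn.
  have jN : j < N by lia.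
  have [||||t2 [s2 [x2 c2 f2 b2 q2]]] :=
    Ip _ _ _ jN Ij (upd g x (edeg g e)) (upd u x d.+1) d.+2 s0 _ _ _ _ erefl erefl b0.
  - lia.
  - by move=> y /=; case: ifP => _ //; apply: ltn_trans NX.
  - by move=> y /=; case: ifP => _; have := ud y; lia.
  - by move=> y /=; case: ifP => _ //; rewrite f0 ?us.
  pose s3 := set_reg (set_reg s2 d.+2 1) d.+1 j.+1.
  have [|||||t4 [s4 [x4 c4 f4 b4 q4]]] := IHi j.+1 s3 _ q2.
  - lia.
  - by rewrite /= !ifN ?f2 //; lia.
  - by rewrite /= eqxx.
  - by move=> y yd; rewrite /= !ifN ?f2 ?f0 //; lia.
  - exact: b2.
  exists (t2 + (1 + 1) + t4).+1, s4; split=> //.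
  - apply: (@exec_while_true _ _ s3) x4; first by rewrite /= dN dj.
    apply: exec_seq x2 _; apply: (@exec_seq _ _ (set_reg s2 d.+2 1)).
      exact: exec_const.
    have /= := @exec_op W (set_reg s2 d.+2 1) Add d.+1 d.+1 d.+2.
    rewrite eqxx ifN; last lia.
    by rewrite f2 // dj addn1; apply; lia.
  - rewrite big_ltn //; lia.
pose s2 := set_reg s1 d.+1 0.
have [||||||t3 [s3 [x3 c3 f3 b3 q3]]] := loop N 0 s2.
- by rewrite addn0.
- by rewrite /= m1 k1 sC.
- by rewrite /= ifN ?v1 //; lia.
- by rewrite /= eqxx.
- by move=> y yd; rewrite /= ifN ?f1 //; lia.
- by rewrite /= m1.
exists (t1 + (1 + t3)), s3; split=> //; last exact: IQ.
- apply: exec_seq x1 _; apply: (@exec_seq _ _ s2) x3; apply: exec_const; lia.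
- rewrite -(big_mkord xpredT (fun j => c j + 3)); lia.
Qed.

Lemma post_for_unif x e p r M C (I : nat -> (nat -> nat) -> (nat -> nat) -> Prop) c Q :
  I 0 M C ->
  (forall j M' C', j < eval r M e -> I j M' C' ->
     post p (upd r x j) M' C' c (I j.+1)) ->
  (forall M' C', I (eval r M e) M' C' -> Q M' C') ->
  post (For x e p) r M C (ecost e + 2 + eval r M e * (c + 3)) Q.
Proof.
move=> I0 Ip IQ; have := post_for (c := fun=> c) I0 Ip IQ.
by rewrite sum_nat_const card_ord.
Qed.

End Hoare.

(** * Tuples as numbers *)

Section Digits.
Variable B : nat.
Hypothesis B_gt0 : 0 < B.

Definition dig (e j : nat) : nat := e %/ B ^ j %% B.
(** Deletes digit [i]: the digits above it move down by one place. The formula needs no unpacking of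
    the tuple, so it is a single expression of the program. *)
Definition drop_dig (e i : nat) : nat := e %/ B ^ i.+1 * B ^ i + e %% B ^ i.

Lemma dig_lt e j : dig e j < B.
Proof. by rewrite ltn_mod. Qed.

Lemma dig_addM a b j c : dig (a * B ^ (j + c.+1) + b) j = dig b j.
Proof.
rewrite /dig expnD expnS mulnCA [B ^ j * _]mulnC divnMDl ?expn_gt0 ?B_gt0 //.
by rewrite mulnCA [B * _]mulnC modnMDl.
Qed.

Lemma dig_drop e i j : dig (drop_dig e i) j = dig e (bump i j).
Proof.
have B0 c : 0 < B ^ c by rewrite expn_gt0 B_gt0.
rewrite /drop_dig /bump; case: leqP => ij.
  have [c ->] : exists c, j = i + c by exists (j - i); lia.
  rewrite /dig add1n -addSn !expnD !divnMA divnMDl // (divn_small (ltn_pmod _ _)) //.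
  by rewrite addn0.
rewrite add0n; have [c ->] : exists c, i = j + c.+1 by exists (i - j).-1; lia.
by rewrite dig_addM {2}(divn_eq e (B ^ (j + c.+1))) dig_addM.
Qed.

Lemma dig_cons k e g j : e < B ^ k -> g < B -> j <= k ->
  dig (e + g * B ^ k) j = if j == k then g else dig e j.
Proof.
move=> ek gB jk; rewrite addnC; case: eqP => [->|/eqP jk'].
  by rewrite /dig divnMDl ?expn_gt0 ?B_gt0 // divn_small // addn0 modn_small.
have [c ->] : exists c, k = j + c.+1 by exists (k - j).-1; lia.
exact: dig_addM.
Qed.

Lemma drop_dig_lt k e i : e < B ^ k.+1 -> i <= k -> drop_dig e i < B ^ k.
Proof.
move=> ek ik; have B0 c : 0 < B ^ c by rewrite expn_gt0 B_gt0.
rewrite /drop_dig (@leq_trans ((e %/ B ^ i.+1).+1 * B ^ i)) //.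
  by rewrite mulSn addnC ltn_add2r ltn_mod.
have -> : B ^ k = B ^ (k - i) * B ^ i by rewrite -expnD subnK.
by rewrite leq_mul2r ltn_divLR // -expnD addnS subnK // ek orbT.
Qed.

Lemma cons_dig_lt k e g : e < B ^ k -> g < B -> e + g * B ^ k < B ^ k.+1.
Proof.
move=> ek gB; rewrite expnS; apply: (@leq_trans (g.+1 * B ^ k)).
  by rewrite mulSn ltn_add2r.
by rewrite leq_mul2r gB orbT.
Qed.

End Digits.

(** * Counting independent sets *)

Section Count.
Variables (n : nat) (G : sgraph 'I_n).
Implicit Types D K A : {set 'I_n}.

Definition count_in D : nat := #|[set A : {set 'I_n} | A \subset D & independent G A]|.

Lemma independentP A : reflect {in A &, forall u v, ~~ G u v} (independent G A).
Proof.
apply: (iffP forall_inP) => [h u v uA vA|h u uA].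
  by have /forall_inP := h u uA; apply.
by apply/forall_inP => v vA; apply: h.
Qed.

Lemma independentS A1 A2 : A1 \subset A2 -> independent G A2 -> independent G A1.
Proof.
move=> /subsetP sA /independentP iA; apply/independentP => u v uA vA.
by apply: iA; apply: sA.
Qed.

Lemma count_in_setT : count_in setT = count_independent_sets G.
Proof. by apply: eq_card => A; rewrite !inE subsetT. Qed.

Lemma count_in_set0 : count_in set0 = 1.
Proof.
rewrite -(cards1 (set0 : {set 'I_n})); apply: eq_card => A; rewrite !inE subset0.
have [->|//] := eqVneq A set0; apply/independentP => u v; by rewrite inE.
Qed.

Lemma count_inU D1 D2 : [disjoint D1 & D2] ->
  (forall u v, u \in D1 -> v \in D2 -> ~~ G u v) ->
  count_in (D1 :|: D2) = count_in D1 * count_in D2.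
Proof.
move=> dD noG; rewrite /count_in -cardsX.
rewrite -(card_in_imset (f := fun p => p.1 :|: p.2)); last first.
  have cut (P1 P2 : {set 'I_n}) : P1 \subset D1 -> P2 \subset D2 ->
      (P1 :|: P2) :&: D1 = P1 /\ (P1 :|: P2) :&: D2 = P2.
    move=> s1 s2; rewrite !setIUl (setIidPl s1) (setIidPl s2).
    have -> : P2 :&: D1 = set0.
      by apply: disjoint_setI0; rewrite disjoint_sym; apply: disjointWr dD.
    have -> : P1 :&: D2 = set0 by apply: disjoint_setI0; apply: disjointWl dD.
    by rewrite setU0 set0U.
  move=> [A1 A2] [A1' A2'] /=; rewrite !inE /= => /andP[/andP[s1 _] /andP[s2 _]].
  move=> /andP[/andP[s1' _] /andP[s2' _]] eqA.
  have [e1 e2] := cut _ _ s1 s2; have [e1' e2'] := cut _ _ s1' s2'.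
  by congr (_, _); [rewrite -e1 eqA e1' | rewrite -e2 eqA e2'].
apply: eq_card => A; rewrite inE; apply/andP/imsetP => [[sA iA]|].
  exists (A :&: D1, A :&: D2); last by rewrite /= -setIUr (setIidPl sA).
  by rewrite !inE /= !subsetIr !(independentS _ iA) ?subsetIl.
move=> [[A1 A2]]; rewrite !inE /= => /andP[/andP[s1 /independentP i1]].
move=> /andP[s2 /independentP i2] ->; split; first exact: setUSS.
apply/independentP => u v; rewrite !inE => /orP[uA|uA] /orP[vA|vA].
- exact: i1.
- by apply: noG; [apply: (subsetP s1) | apply: (subsetP s2)].
- by rewrite adj_sym; apply: noG; [apply: (subsetP s1) | apply: (subsetP s2)].
- exact: i2.
Qed.

(** An independent set meets a clique in at most one vertex. Those that miss [K] give the first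
    term; those that contain [u] correspond, by deleting [u], to independent sets outside [K]
    without neighbours of [u]. *)
Lemma count_in_clique D K : K \subset D -> clique G K ->
  count_in D = count_in (D :\: K)
    + \sum_(u in K) count_in [set w in D :\: K | ~~ G u w].
Proof.
move=> KD cK; rewrite /count_in.
(* Exactly one of these indicators is 1, so each set counts once and the order of summation can be
   exchanged. *)
have splitA (A : {set 'I_n}) : independent G A ->
    1 = (A :&: K == set0) + \sum_(u in K) (u \in A : nat).
  move=> iA; have [A0|[u]] := set_0Vmem (A :&: K).
    rewrite A0 eqxx big1 // => u uK; apply/eqP; rewrite eqb0.
    by apply/negP => uA; move: (in_set0 u); rewrite -A0 inE uA uK.
  rewrite inE => /andP[uA uK]; rewrite (bigD1 u) //= uA big1 ?addn0.
    by have /negPf-> : A :&: K != set0 by apply/set0Pn; exists u; rewrite inE uA.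
  move=> v /andP[vK vu]; apply/eqP; rewrite eqb0; apply/negP => vA.
  by have /independentP/(_ v u vA uA) := iA; rewrite cK.
rewrite -sum1_card (eq_bigr (fun A => (A :&: K == set0) + \sum_(u in K) (u \in A : nat)));
  last by move=> A; rewrite inE => /andP[_ iA]; apply: splitA.
rewrite big_split /= -sum1_card; congr (_ + _).
  rewrite big_mkcond [RHS]big_mkcond; apply: eq_bigr => A _ /=; rewrite !inE.
  rewrite subsetD -setI_eq0; case: (A \subset D) => //=.
  by case: (_ == _); case: (independent _ _).
rewrite exchange_big; apply: eq_bigr => u uK /=.
have uD := subsetP KD u uK.
transitivity #|[set A : {set 'I_n} | [&& A \subset D, independent G A & u \in A]]|.
  rewrite -sum1_card big_mkcond [RHS]big_mkcond; apply: eq_bigr => A _; rewrite !inE.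
  by case: (A \subset D); case: (independent G A); case: (u \in A).
have uU (A : {set 'I_n}) : A \subset [set w in D :\: K | ~~ G u w] -> u \notin A.
  by move=> sA; apply/negP => /(subsetP sA); rewrite !inE uK.
rewrite -[RHS](card_in_imset (f := fun A => u |: A)); last first.
  move=> A A'; rewrite !inE => /andP[/uU uA _] /andP[/uU uA' _] eqA.
  by rewrite -(setU1K uA) eqA setU1K.
apply: eq_card => A; rewrite inE; apply/and3P/imsetP => [[sA iA uA]|].
  exists (A :\ u); last by rewrite setD1K.
  rewrite inE (independentS (subD1set _ _) iA) andbT.
  apply/subsetP => w; rewrite !inE => /andP[wu wA].
  have /independentP := iA => {}iA.
  rewrite (subsetP sA) // iA // !andbT; apply: contra (iA w u wA uA).
  by move=> wK; apply: cK.
move=> [A']; rewrite inE => /andP[sA' iA'] ->; split.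
- rewrite subUset sub1set uD; apply/subsetP => w /(subsetP sA').
  by rewrite !inE => /andP[/andP[]].
- apply/independentP => w w'; rewrite !inE => /orP[/eqP->|wA] /orP[/eqP->|wA'].
  + by rewrite adj_irr.
  + by have := subsetP sA' _ wA'; rewrite !inE => /andP[].
  + by rewrite adj_sym; have := subsetP sA' _ wA; rewrite !inE => /andP[].
  + by have /independentP := iA'; apply.
- by rewrite !inE eqxx.
Qed.

End Count.

(** * Separators, components and choices *)

Section Rep.
Variables (m : nat) (R : rel 'I_m).
Hypothesis symR : symmetric R.

(* With the largest vertex as representative, a component that occurs for several
   separators has the same label for all of them. *)
Definition rep (x : 'I_m) : nat := \max_(y | connect R x y) y.

Lemma rep_connect x : exists2 y : 'I_m, connect R x y & rep x = y.
Proof.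
have x0 : 0 < #|[pred y | connect R x y]| by apply/card_gt0P; exists x; apply: connect0.
by have [y xy max_y] := eq_bigmax_cond val x0; exists y.
Qed.

Lemma rep_same x y : connect R x y -> rep x = rep y.
Proof.
by move=> xy; apply: eq_bigl => z; apply: (same_connect (sym_connect_sym symR)).
Qed.

Lemma rep_eq x y : (rep x == rep y) = connect R x y.
Proof.
apply/eqP/idP; last exact: rep_same.
have [x' xx' ->] := rep_connect x; have [y' yy' ->] := rep_connect y.
move/val_inj => eqxy; apply: connect_trans xx' _.
by rewrite eqxy (sym_connect_sym symR).
Qed.

Lemma rep_lt x : rep x < m.
Proof. by have [y _ ->] := rep_connect x. Qed.

Lemma rep_ge x y : connect R x y -> y <= rep x.
Proof. by move=> xy; apply: (@leq_bigmax_cond _ _ (fun y : 'I_m => val y)). Qed.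

Lemma rep_unique x (z : 'I_m) :
  connect R x z -> (forall y, connect R x y -> y <= z) -> rep x = z.
Proof.
move=> xz zmax; apply/eqP; rewrite eqn_leq rep_ge // andbT.
by have [y xy ->] := rep_connect x; apply: zmax.
Qed.

End Rep.

Lemma eq_rep m (R R' : rel 'I_m) x :
  (forall y, connect R x y = connect R' x y) -> rep R x = rep R' x.
Proof. by move=> eqR; apply: eq_bigl. Qed.

Section Spec.
Variables (k n m : nat) (G : sgraph 'I_n) (H : sgraph 'I_m) (psi : 'I_n -> 'I_m).
Implicit Types (e l g i j : nat) (x y : 'I_m) (u w : 'I_n).

(* The options: [o < m] is the vertex [o] of [H] with no vertex of its clique
   chosen, [m] is a dummy, and [m.+1 + u] is the choice of [u] in [psi u]. *)
Definition nopt : nat := (n + m).+1.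

(** The program sees options as bare numbers, so [psi] is made total, with the dummy [m] as default
    value. *)
Definition psin (u : nat) : nat := if insub u is Some u' then psi u' else m.

Definition proj (o : nat) : nat := if m < o then psin (o - m.+1) else o.

Lemma noptE : nopt = (n + m).+1. Proof. by []. Qed.

Notation dig := (dig nopt).
Notation drop_dig := (drop_dig nopt).

Lemma nopt_gt0 : 0 < nopt. Proof. by []. Qed.

Definition sep l e : {set 'I_m} := [set x : 'I_m | [exists j : 'I_l, proj (dig e j) == x]].

Definition chosen l e : {set 'I_n} := [set u : 'I_n | [exists j : 'I_l,
  dig e j == m.+1 + u]].

(** Several digits may name the same vertex of [H]; the tuple stands for a choice only if they are
    the same option. Repeated digits and dummies let one tuple length serve all smaller
    separators. *)
Definition consistent l e : Prop := forall i j, i < l -> j < l ->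
  proj (dig e i) = proj (dig e j) -> dig e i = dig e j.

Definition outside l e : rel 'I_m :=
  [rel x y | [&& H x y, x \notin sep l e & y \notin sep l e]].

Lemma outsideE l e x y :
  outside l e x y = [&& H x y, x \notin sep l e & y \notin sep l e].
Proof. by []. Qed.

Definition avoid l e : {set 'I_n} := [set w | [forall u in chosen l e, ~~ G u w]].

(* The junk value [m] marks the vertices of the separator and the dummy [m]. *)
Definition label l e (x : nat) : nat :=
  if insub x is Some x' then
    if x' \in sep l e then m else rep (outside l e) x'
  else m.

(** The number [N(S, C)] of the overview is [count_in G (ext l e x)], for any [x] in [C]. *)
Definition ext l e x : {set 'I_n} :=
  [set w | connect (outside l e) x (psi w) & w \in avoid l e].

Lemma in_ext l e x w :
  (w \in ext l e x) = connect (outside l e) x (psi w) && (w \in avoid l e).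
Proof. by rewrite /ext in_set. Qed.

Definition compatible l e g : bool :=
  [forall u in chosen l e, forall w : 'I_n, (g == m.+1 + w) ==> ~~ G u w].

Lemma psinE u : psin u = psi u.
Proof. by rewrite /psin valK. Qed.

Lemma proj_vertex u : proj (m.+1 + u) = psi u.
Proof. by rewrite /proj addSn ltnS leq_addr -addSn addKn psinE. Qed.

Lemma proj_small o : o <= m -> proj o = o.
Proof. by rewrite /proj ltnNge => ->. Qed.

Lemma proj_le o : proj o <= m.
Proof.
rewrite /proj; case: ltnP => // _; rewrite /psin; case: insubP => // u' _ _.
exact: ltnW.
Qed.

Lemma outside_sym l e : symmetric (outside l e).
Proof. by move=> x y; rewrite /outside /= adj_sym; congr (_ && _); rewrite andbC. Qed.

Lemma connect_outside_sym l e : connect_sym (outside l e).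
Proof. exact/sym_connect_sym/outside_sym. Qed.

Lemma connect_outside l e x y :
  x \notin sep l e -> connect (outside l e) x y -> y \notin sep l e.
Proof.
by move=> xS /(connect_invariant (f := fun z =>
  z \notin sep l e)) <- // a b /and3P[_ -> ->].
Qed.

Lemma labelE l e x : x \notin sep l e -> label l e x = rep (outside l e) x.
Proof. by move=> xS; rewrite /label valK (negPf xS). Qed.

Lemma label_sep l e x : x \in sep l e -> label l e x = m.
Proof. by move=> xS; rewrite /label valK xS. Qed.

Lemma label_m l e : label l e m = m.
Proof. by rewrite /label insubF ?ltnn. Qed.

Lemma label_lt l e x : (label l e x < m) = (x \notin sep l e).
Proof.
have [xS|xS] := boolP (x \in sep l e); first by rewrite label_sep // ltnn.
by rewrite labelE // rep_lt.
Qed.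

Lemma label_le l e (x : nat) : label l e x <= m.
Proof.
rewrite /label; case: insubP => // x' _ _; case: ifP => // _.
by apply: ltnW; apply: rep_lt.
Qed.

Lemma label_eq l e x y : x \notin sep l e ->
  (label l e x == label l e y) = connect (outside l e) x y.
Proof.
move=> xS; rewrite labelE //; have [yS|yS] := boolP (y \in sep l e).
  rewrite label_sep // ltn_eqF ?rep_lt //; apply/esym/negbTE.
  by apply: contraL yS => /(connect_outside xS).
by rewrite labelE // rep_eq //; apply: outside_sym.
Qed.

Lemma sepP l e x : reflect (exists2 j, j < l & proj (dig e j) = x) (x \in sep l e).
Proof.
rewrite inE; apply: (iffP existsP) => [[j /eqP]|[j jl /eqP]]; first by exists j.
by exists (Ordinal jl).
Qed.

Lemma chosenP l e u : reflect (exists2 j, j < l & dig e j = m.+1 + u) (u \in chosen l e).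
Proof.
rewrite inE; apply: (iffP existsP) => [[j /eqP]|[j jl /eqP]]; first by exists j.
by exists (Ordinal jl).
Qed.

Lemma avoidP l e w : reflect (forall u, u \in chosen l e -> ~~ G u w) (w \in avoid l e).
Proof. by rewrite /avoid in_set; apply: (iffP forall_inP). Qed.

Section Extend.
Variables (e g : nat).
Hypotheses (e_lt : e < nopt ^ k) (g_lt : g < nopt).
Notation e' := (e + g * nopt ^ k).

Lemma dig_last : dig e' k = g.
Proof. by rewrite dig_cons // eqxx. Qed.

Lemma dig_init j : j < k -> dig e' j = dig e j.
Proof. by move=> jk; rewrite dig_cons ?(ltnW jk) // ltn_eqF. Qed.

Lemma sep_cons x : (x \in sep k.+1 e') = (x \in sep k e) || (proj g == x).
Proof.
apply/sepP/orP => [[j]|[/sepP[j jk jx]|/eqP gx]].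
- rewrite ltnS leq_eqVlt => /orP[/eqP->|jk].
    by rewrite dig_last => /eqP; right.
  by rewrite dig_init // => jx; left; apply/sepP; exists j.
- by exists j; rewrite ?dig_init // ltnW.
- by exists k; rewrite ?dig_last.
Qed.

Lemma chosen_cons u : (u \in chosen k.+1 e') = (u \in chosen k e) || (g == m.+1 + u).
Proof.
apply/chosenP/orP => [[j]|[/chosenP[j jk eqj]|/eqP eqg]].
- rewrite ltnS leq_eqVlt => /orP[/eqP->|jk].
    by rewrite dig_last => /eqP; right.
  by rewrite dig_init // => jx; left; apply/chosenP; exists j.
- by exists j; rewrite ?dig_init // ltnW.
- by exists k; rewrite ?dig_last.
Qed.

Lemma consistent_cons x : consistent k e -> proj g = x -> x \notin sep k e ->
  consistent k.+1 e'.
Proof.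
move=> ce gx xS i j; rewrite !ltnS [i <= k]leq_eqVlt [j <= k]leq_eqVlt.
move=> /orP[/eqP->|ik] /orP[/eqP->|jk]; rewrite ?dig_last ?dig_init // => eqp.
- by case/sepP: xS; exists j; rewrite // -eqp.
- by case/sepP: xS; exists i; rewrite // eqp.
- exact: ce.
Qed.

End Extend.

Section Drop.
Variables (e i : nat).
Hypothesis i_le : i <= k.
Notation d := (drop_dig e i).
Notation x_i := (proj (dig e i)).

Lemma dig_bump j : dig d j = dig e (bump i j).
Proof. exact: dig_drop. Qed.

Lemma bump_le j : j < k -> bump i j < k.+1.
Proof. by rewrite /bump; case: leqP; lia. Qed.

Lemma unbump_lt j : j < k.+1 -> j != i -> unbump i j < k.
Proof. by rewrite /unbump; case: ltnP; lia. Qed.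

Lemma dig_unbump j : j != i -> dig d (unbump i j) = dig e j.
Proof. by move=> ji; rewrite dig_bump unbumpK // inE. Qed.

Lemma sep_drop x : (x \in sep k.+1 e) = (x \in sep k d) || (x_i == x).
Proof.
apply/sepP/orP => [[j jk jx]|[/sepP[j jk jx]|/eqP jx]].
- have [<-|ji] := eqVneq j i; first by right; rewrite jx.
  by left; apply/sepP; exists (unbump i j); rewrite ?unbump_lt ?dig_unbump.
- by exists (bump i j); rewrite ?bump_le // -dig_bump.
- by exists i.
Qed.

Lemma chosen_drop u : (u \in chosen k.+1 e) = (u \in chosen k d) || (dig e i == m.+1 + u).
Proof.
apply/chosenP/orP => [[j jk Du]|[/chosenP[j jk Du]|/eqP Du]].
- have [<-|ji] := eqVneq j i; first by right; rewrite Du.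
  by left; apply/chosenP; exists (unbump i j); rewrite ?unbump_lt ?dig_unbump.
- by exists (bump i j); rewrite ?bump_le // -dig_bump.
- by exists i.
Qed.

Lemma consistent_drop : consistent k.+1 e -> consistent k d.
Proof. by move=> ce a b ak bk; rewrite !dig_bump; apply: ce; apply: bump_le. Qed.

Variable x : 'I_m.
Hypotheses (xS : x \notin sep k.+1 e) (label_neq : label k d x != label k d x_i).

Lemma sep_dropN : x \notin sep k d.
Proof. by apply: contra xS; rewrite sep_drop => ->. Qed.

(** When the separator shrinks, the component of [x] can grow only by absorbing the dropped vertex,
    and then the two labels in [label_neq] would agree. If the dropped digit is a dummy or is
    repeated elsewhere, its label is [m] and differs anyway. *)
Lemma connect_drop y : connect (outside k.+1 e) x y = connect (outside k d) x y.
Proof.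
apply/idP/idP; apply: connect_sub_from => a b xa /= /and3P[ab aS bS].
  apply: connect1; move: aS bS; rewrite /outside /= ab !sep_drop.
  by rewrite !negb_or => /andP[-> _] /andP[-> _].
have neq z : connect (outside k d) x z -> z \notin sep k d -> z \notin sep k.+1 e.
  move=> xz zS; rewrite sep_drop (negPf zS) /=; apply: contraNneq label_neq => ->.
  by rewrite label_eq ?sep_dropN.
have xb : connect (outside k d) x b.
  by apply: connect_trans xa (connect1 _); rewrite /outside /= ab aS.
by apply: connect1; rewrite /outside /= ab !neq.
Qed.

Lemma label_drop : label k d x = label k.+1 e x.
Proof.
by rewrite !labelE ?sep_dropN //; apply: eq_rep => y; rewrite connect_drop.
Qed.

(* A dropped vertex of [H] has no neighbour in the component of [x], by [label_neq]. *)
Hypothesis G_H : forall u w, G u w -> psi u = psi w \/ H (psi u) (psi w).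

Lemma ext_drop : consistent k.+1 e -> ext k d x = ext k.+1 e x.
Proof.
move=> ce; apply/setP => w; rewrite [LHS]inE [RHS]inE connect_drop.
apply: andb_id2l => xw; rewrite /avoid !inE.
apply/forall_inP/forall_inP => h u; last by move=> ud; apply: h; rewrite chosen_drop ud.
rewrite chosen_drop => /orP[|/eqP Du]; first exact: h.
have xiE : x_i = psi u by rewrite Du proj_vertex.
apply/negP => Guw; have wS := connect_outside sep_dropN xw.
have wSe : psi w \notin sep k.+1 e.
  by rewrite -connect_drop in xw; apply: connect_outside xw.
have uSe : psi u \in sep k.+1 e by rewrite sep_drop xiE eqxx orbT.
case: (G_H Guw) => [eq_uw|Huw]; first by rewrite -eq_uw uSe in wSe.
(* The vertex [psi u] may still be named by another digit; consistency makes that digit choose [u]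
   as well. *)
have [/sepP[j jk /esym Dj]|uS] := boolP (psi u \in sep k d).
  suff ud : u \in chosen k d by have := h u ud; rewrite Guw.
  apply/chosenP; exists j => //; rewrite -Du dig_bump; apply: ce.
  - exact: bump_le.
  - exact: i_le.
  - by rewrite -dig_bump -Dj -xiE.
move/eqP: label_neq; apply; rewrite xiE; apply/eqP; rewrite label_eq ?sep_dropN //.
apply: connect_trans xw (connect1 _); by rewrite /outside /= adj_sym Huw wS uS.
Qed.

End Drop.

End Spec.

(** * Entries on which the search is bound to succeed *)

Section Tame.
Variables (k n m : nat) (H : sgraph 'I_m) (psi : 'I_n -> 'I_m).
Variable D : tree_decomposition H.
Hypothesis widthD : width D <= k.
Notation nopt := (nopt n m).
Notation dig := (dig nopt).
Notation drop_dig := (drop_dig nopt).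
Notation sep := (sep psi).
Notation outside := (outside H psi).
Notation label := (label H psi).
Notation proj := (proj psi).

Definition component l e (x : 'I_m) : {set 'I_m} := [set y | connect (outside l e) x y].

Definition tame l e (x : 'I_m) : Prop :=
  x \notin sep l e /\ exists t : node D, nbh H (component l e x) \subset bag t.

(** If no digit could be dropped, each of the [k.+1] digits would be the only one to name some
    element of [A]; these elements are distinct, too many for [A]. *)
Lemma exists_drop e (A : {set 'I_m}) : A \subset sep k.+1 e -> #|A| <= k ->
  exists2 i, i <= k & A \subset sep k (drop_dig e i).
Proof.
move=> sA Ak; have [/existsP[i iA]|no] :=
    boolP [exists i : 'I_k.+1, A \subset sep k (drop_dig e i)].
  by exists i; rewrite // -ltnS.
have witness (i : 'I_k.+1) : exists x : 'I_m, [/\ x \in A, x \notin sep k (drop_dig e i)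
    & proj (dig e i) = x].
  have /existsPn/(_ i)/subsetPn[x xA xS] := no.
  exists x; split=> //; have := subsetP sA x xA.
  by rewrite (@sep_drop _ _ _ _ _ i) ?leq_ord // (negPf xS) => /eqP.
have [f fP] := fin_all_exists witness.
have f_inj : injective f.
  move=> i j eqf; apply/eqP; apply: contraT => ij.
  have [_ /sepP[]] := fP i; exists (unbump i j).
    by apply: unbump_lt; [exact: leq_ord | exact: ltn_ord | rewrite eq_sym].
  by rewrite dig_unbump 1?eq_sym // eqf; have [] := fP j.
have : #|f @: 'I_k.+1| <= k.
  apply: leq_trans Ak; apply/subset_leq_card/subsetP => _ /imsetP[i _ ->].
  by have [] := fP i.
by rewrite card_imset // card_ord ltnn.
Qed.

Lemma component_connected l e x :
  {in component l e x &, forall a b, connect (inside H (component l e x)) a b}.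
Proof.
move=> a b; rewrite !inE => xa xb.
have ab : connect (outside l e) a b.
  by apply: connect_trans xb; rewrite connect_outside_sym.
apply: connect_sub_from ab => c d ac cd; apply: connect1.
rewrite /inside /= !inE (connect_trans xa ac) (connect_trans xa (connect_trans ac (connect1
  cd))).
by case/and3P: cd => ->.
Qed.

Lemma component_neq0 l e x : component l e x != set0.
Proof. by apply/set0Pn; exists x; rewrite inE. Qed.

Lemma nbh_component l e x : x \notin sep l e -> nbh H (component l e x) \subset sep l e.
Proof.
move=> xS; apply/subsetP => z; rewrite inE => /andP[zC /exists_inP[c]].
rewrite inE => xc cz; apply: contraR zC => zS; rewrite inE.
have cS := connect_outside xS xc.
by apply: connect_trans xc (connect1 _); rewrite /outside /= cz zS cS.
Qed.

Lemma bag_size (t : node D) : #|bag t| <= k.+1.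
Proof.
have := @leq_bigmax _ (fun t : node D => #|bag t|) t; move: widthD; rewrite /width.
by case: (\max_t _); lia.
Qed.

(* Full separators would not fit in [k] digits; but if the [k+1] neighbours of
   the component of [y] filled a bag, [bag_meeting] would give a larger bag. *)
Lemma tame_step e x : e < nopt ^ k -> tame k e x ->
  exists2 v : 'I_m, connect (outside k e) x v & forall y,
    connect (outside k e) x y -> y != v ->
  forall g, g < nopt -> proj g = v -> exists2 i, i <= k &
    let e' := e + g * nopt ^ k in
    label k (drop_dig e' i) y != label k (drop_dig e' i) (proj (dig e' i)) /\
    tame k (drop_dig e' i) y.
Proof.
move=> ek [xS [t0 nt0]].
have [t nt /exists_inP[v]] := bag_meeting (component_neq0 _ _ _) (@component_connected k e
  x) nt0.
rewrite inE => xv vt; exists v => // y xy yv g gB gv; set e' := e + g * nopt ^ k.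
have sepE z : (z \in sep k.+1 e') = (z \in sep k e) || (v == z).
  by rewrite sep_cons // gv.
have yS : y \notin sep k.+1 e'.
  by rewrite sepE (negPf (connect_outside xS xy)) eq_sym.
have subC z : connect (outside k.+1 e') y z -> connect (outside k e) x z.
  move=> yz; apply: connect_trans xy _; apply: connect_sub yz => a b /= /and3P[ab].
  rewrite !sepE !negb_or => /andP[aS _] /andP[bS _].
  by apply: connect1; rewrite /outside /= ab aS.
set C := component k.+1 e' y.
have nCS : nbh H C \subset sep k.+1 e' by apply: nbh_component.
(* A neighbour of [C] is [v], which is in the bag, or lies in the old separator and is then a
   neighbour of the component of [x]. *)
have nCt : nbh H C \subset bag t.
  apply/subsetP => z zC; have := subsetP nCS z zC; rewrite sepE => /orP[zS|/eqP<-//].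
  apply: (subsetP nt); move: zC; rewrite !inE => /andP[_ /exists_inP[c]].
  rewrite inE => /subC xc cz; apply/andP; split.
    by apply: contraL zS => /(connect_outside xS).
  by apply/exists_inP; exists c; rewrite ?inE.
have nCk : #|nbh H C| <= k.
  rewrite leqNgt; apply/negP => kC.
  have [t' nCt' /exists_inP[z zC zt']] :=
    bag_meeting (component_neq0 _ _ _) (@component_connected k.+1 e' y) nCt.
  have : z |: nbh H C \subset bag t' by rewrite subUset sub1set zt'.
  move/subset_leq_card; rewrite cardsU1 !inE /=.
  rewrite inE in zC; rewrite zC add1n => lt_bag.
  by have := leq_trans lt_bag (bag_size t'); rewrite ltnS leqNgt kC.
have [i ik nCd] := exists_drop nCS nCk; exists i => //; set d := drop_dig e' i in nCd *.
have sub_sep z : z \in sep k d -> z \in sep k.+1 e' by rewrite (sep_drop _ _ ik) => ->.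
have yd : y \notin sep k d by apply: contra yS; apply: sub_sep.
(* A path that leaves [C] passes through a neighbour of [C], and all of these remain in the smaller
   separator. *)
have compE z : connect (outside k d) y z = (z \in C).
  rewrite inE; apply/idP/idP => yz.
    have [//|zC] := boolP (connect (outside k.+1 e') y z).
    have yC : y \notin [predC C] by rewrite inE /= inE negbK connect0.
    have zC' : z \in [predC C] by rewrite inE /= inE.
    have [p [q [_ pC pq qC]]] := connect_exit yz yC zC'.
    move: pC qC pq; rewrite !inE negbK => yp yq /and3P[pq pS qS].
    have : q \in nbh H C by rewrite !inE yq; apply/exists_inP; exists p; rewrite ?inE.
    by move/(subsetP nCd); rewrite (negPf qS).
  apply: connect_sub yz => a b /= /and3P[ab aS bS]; apply: connect1.
  by rewrite /outside /= ab /=; apply/andP; split; [apply: contra aS | apply: contra bS];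
    apply: sub_sep.
split.
  have: proj (dig e' i) <= m by apply: proj_le.
  rewrite leq_eqVlt => /orP[/eqP->|lt_m].
    by rewrite label_m ltn_eqF // label_lt.
  have -> : proj (dig e' i) = Ordinal lt_m by [].
  rewrite label_eq // compE inE; apply/negP => /(connect_outside yS)/negP; apply.
  by rewrite (sep_drop _ _ ik); apply/orP; right.
split=> //; exists t; suff -> : component k d y = C by [].
by apply/setP => z; rewrite -compE inE.
Qed.

End Tame.

(** * Product over components and sum over options *)

Section CountSteps.
Variables (n m : nat) (G : sgraph 'I_n) (H : sgraph 'I_m) (psi : 'I_n -> 'I_m).
Hypothesis G_H : forall u w, G u w -> psi u = psi w \/ H (psi u) (psi w).
Hypothesis G_clique : forall x, clique G (psi @^-1: [set x]).

Section Components.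
Variables (R : rel 'I_m) (P : pred 'I_m) (A : {set 'I_n}).
Hypotheses (symR : symmetric R) (PR : forall x y, R x y -> P x = P y).
Hypothesis HR : forall x y, P x -> P y -> H x y -> R x y.

(** The program forms a product over components by a loop over all vertices of [H], multiplying when
    it meets a representative. This is the part of [G] covered once the vertices below [r] are
    treated. *)
Definition rep_below (r : nat) : {set 'I_n} :=
  [set w | [&& P (psi w), rep R (psi w) < r & w \in A]].

(** If [x] represents a component, no edge of [G] joins it to those already covered: an edge lies
    over one vertex of [H] or over an edge of [H], whose ends share a component. Otherwise nothing
    new is covered. *)
Lemma count_rep_step (x : 'I_m) : count_in G (rep_below x.+1) =
  count_in G (rep_below x) *
  (if P x && (rep R x == x) then count_in G [set w | connect R x (psi w) & w \in A] else 1).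
Proof.
have PRc y z : connect R y z -> P y = P z by apply: connect_invariant.
case: ifP => [/andP[Px /eqP rx]|Pr].
  rewrite -count_inU.
  - congr count_in; apply/setP => w; rewrite !inE ltnS leq_eqVlt.
    have -> : connect R x (psi w) = P (psi w) && (rep R (psi w) == x).
      rewrite -[in RHS]rx eq_sym rep_eq //; case: (boolP (connect R x _)) => [/PRc<-|].
        by rewrite Px.
      by rewrite andbF.
    by case: (P _); case: (w \in A); rewrite ?andbT ?andbF //= orbC.
  - rewrite disjoint_subset; apply/subsetP => w; rewrite !inE => /and3P[_ lt_x _].
    apply/negP => /andP[/(rep_same symR) xw _].
    by move: lt_x; rewrite -xw rx ltnn.
  - move=> u w; rewrite !inE => /and3P[Pu lt_x _] /andP[xw _]; apply/negP => Guw.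
    have uw : connect R (psi u) (psi w).
      case: (G_H Guw) => [->//|Huw]; apply: connect1; apply: HR => //.
      by rewrite -(PRc _ _ xw).
    by move: lt_x; rewrite (rep_same symR uw) -(rep_same symR xw) rx ltnn.
rewrite muln1; congr count_in; apply/setP => w; rewrite !inE ltnS leq_eqVlt.
case: eqP => //= rw; have [y wy Dy] := rep_connect R (psi w).
have yx : y = x by apply: val_inj; rewrite /= -Dy.
rewrite yx in wy; move: Pr; rewrite -(rep_same symR wy) rw eqxx andbT (PRc _ _ wy) => -> //.
Qed.

Lemma rep_below0 : count_in G (rep_below 0) = 1.
Proof.
by rewrite -(count_in_set0 G); congr count_in; apply/setP => w; rewrite !inE andbF.
Qed.

Lemma rep_below_all : rep_below m = [set w | P (psi w) & w \in A].
Proof. by apply/setP => w; rewrite !inE rep_lt. Qed.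

End Components.

Variable k : nat.
Notation nopt := (nopt n m).
Notation outside := (outside H psi).
Notation sep := (sep psi).
Notation ext := (ext G H psi).

(** Among the options up to [m] only [v] itself projects to [v], and it chooses nothing, so it is
    always compatible. The others are the vertices [u] above [v], for which compatibility is
    membership in [avoid]. *)
Lemma sum_proj (e : nat) (v : 'I_m) (f : nat -> nat) :
  \sum_(g < nopt | (proj psi g == v) && compatible m G k e g) f g =
  f v + \sum_(u | (psi u == v) && (u \in avoid m G k e)) f (m.+1 + u).
Proof.
rewrite -(big_mkord (fun g => (proj psi g == v) && compatible m G k e g) f).
rewrite /nopt -addnS addnC (big_cat_nat _ (n := m.+1)) //=; last by rewrite leq_addr.
congr (_ + _).
  rewrite big_mkord (bigD1 (widen_ord (leqnSn m) v)) /=; last first.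
    rewrite proj_small ?eqxx ?(ltnW (ltn_ord v)) //=.
    apply/forall_inP => u _; apply/forallP => w; apply/implyP => /eqP Dv.
    by have := ltn_ord v; rewrite Dv; lia.
  rewrite big1 ?addn0 // => g /andP[/andP[/eqP gv _] /eqP gne]; case: gne.
  by apply: val_inj; rewrite /= -gv proj_small // -ltnS.
rewrite -{1}[m.+1]add0n big_addn addKn big_mkord; apply: eq_big => u; last by rewrite addnC.
rewrite addnC proj_vertex; congr (_ && _); rewrite /compatible /avoid inE.
apply/forall_inP/forall_inP => h w wc; have := h w wc; last first.
  move=> nG; apply/forallP => u'; apply/implyP; rewrite eqn_add2l => /eqP/val_inj<-.
  by [].
by move/forallP/(_ u); rewrite eqxx.
Qed.

(** The recurrence at [v]: [count_in_clique] for the part of [ext k e v] above [v]. Its first term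
    is the option [v], its sum runs over the options [m.+1 + u]. *)
Lemma count_ext_split e (v : 'I_m) : e < nopt ^ k -> v \notin sep k e ->
  count_in G (ext k e v) =
  \sum_(g < nopt | (proj psi g == v) && compatible m G k e g)
    count_in G [set w | (connect (outside k e) v (psi w) && (psi w != v))
                      & w \in avoid m G k.+1 (e + g * nopt ^ k)].
Proof.
move=> ek vS.
rewrite (sum_proj e v (fun g => count_in G [set w | (connect (outside k e) v (psi w)
  && (psi w != v)) & w \in avoid m G k.+1 (e + g * nopt ^ k)])).
pose K := [set w in ext k e v | psi w == v].
rewrite (@count_in_clique _ _ _ K); last first.
- move=> u w; rewrite !inE => /andP[_ uv] /andP[_ wv]; by move/(_ u w): (@G_clique v);
  apply; rewrite !inE.
- by apply/subsetP => w; rewrite inE => /andP[].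
have chosenS g : g < nopt -> chosen n m k.+1 (e + g * nopt ^ k) =
    chosen n m k e :|: [set u : 'I_n | g == m.+1 + u].
  by move=> gB; apply/setP => u; rewrite in_setU chosen_cons //; congr (_ || _);
    rewrite in_set.
have extE w : (w \in ext k e v) = connect (outside k e) v (psi w) && (w \in avoid m G k e).
  by rewrite /ext in_set.
have KE w : (w \in K) = (w \in ext k e v) && (psi w == v) by rewrite /K in_set.
congr (_ + _).
  have -> : avoid m G k.+1 (e + v * nopt ^ k) = avoid m G k e.
    suff eq_chosen : chosen n m k.+1 (e + v * nopt ^ k) = chosen n m k e.
      by apply/setP => w; rewrite /avoid !in_set eq_chosen.
    rewrite chosenS; last by rewrite /nopt; have := ltn_ord v; lia.
    apply/setP => u; rewrite in_setU [X in _ || X]in_set; case: eqP; rewrite ?orbF // => Dv.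
    by have := ltn_ord v; rewrite Dv; lia.
  congr count_in; apply/setP => w; rewrite in_setD KE extE [RHS]in_set.
  by case: (connect _ v _); case: (psi w == v); case: (w \in _).
apply: eq_big => u.
  by rewrite KE extE andbC; case: eqP => [->|] //=; rewrite connect0.
rewrite KE extE => /andP[/andP[vu uA] uv]; congr count_in; apply/setP => w.
rewrite in_set in_setD KE extE [RHS]in_set.
case: (connect _ v _) => //=; case: (psi w == v); rewrite ?andbF ?andbT ?andNb //=.
have {}chosenS : chosen n m k.+1 (e + (m.+1 + u) * nopt ^ k) =
    chosen n m k e :|: [set u' : 'I_n | m.+1 + u == m.+1 + u'].
  by apply: chosenS; rewrite /nopt; have := ltn_ord u; lia.
apply/andP/avoidP => [[/avoidP h nG] z|h]; rewrite ?chosenS.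
  rewrite in_setU [X in _ || X]in_set eqn_add2l eq_sym => /orP[zc|/eqP/val_inj->//].
  exact: h.
split; last by apply: h; rewrite chosenS in_setU [X in _ || X]in_set eqxx orbT.
by apply/avoidP => z zc; apply: h; rewrite chosenS in_setU zc.
Qed.

End CountSteps.

(** * The program *)

Section Program.
Variable k : nat.

Definition add := Bin Add.
Definition sub := Bin Defs.Sub.
Definition mul := Bin Mul.
Definition eN := Mem (Cst 0).
Definition eM := Mem (Cst 1).
Definition eM1 := add eM (Cst 1).
Definition eB := add (add eN eM) (Cst 1).
Definition eBase := add (add (add (Cst 2) eN) (mul eN eN)) (mul eM eM).
(** Four interleaved tables behind the flag word at [eBase]; rows have length [m + 1] because the
    dummy [m] is a legal second index. *)
Definition eCell (f : nat) (a x : expr) : expr :=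
  add (add eBase (Cst f)) (mul (Cst 4) (add (mul a eM1) x)).
(** The offset 3 skips the working counters 0, 1 and 2. *)
Definition eCount (a x : expr) : expr := add (Cst 3) (add (mul a eM1) x).
(** As [k] is fixed, powers, digits and searches over digits are unrolled into expressions, of
    constant cost. *)
Definition ePow (j : nat) : expr := iter j (mul eB) (Cst 1).
Definition eDig (e : expr) (j : nat) : expr := Bin Mod (Bin Div e (ePow j)) eB.
Definition eDrop (e : expr) (i : nat) : expr :=
  add (mul (Bin Div e (ePow i.+1)) (ePow i)) (Bin Mod e (ePow i)).
Definition eProj (o : expr) : expr :=
  Cond (Ltb eM o) (Mem (add (Cst 2) (sub o eM1))) o.
Definition eG (u w : expr) : expr := Mem (add (add (add (Cst 2) eN) (mul u eN)) w).
Definition eH (x y : expr) : expr :=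
  Mem (add (add (add (add (Cst 2) eN) (mul eN eN)) (mul x eM)) y).
Definition eLabel (a x : expr) : expr := Mem (eCell 1 a x).
Definition eAny (c v : nat -> expr) (s : seq nat) : expr :=
  foldr (fun j e => Cond (c j) (v j) e) (Cst 0) s.
Definition eNull : expr := iter k (fun e => add (mul e eB) eM) (Cst 0).

(* Variables: 0 is the index [e] of a [k]-tuple of options, 1 the vertex [v] (or
   the vertex inserted), 3 the stage, 4 the option above [v], 5 the index of the
   [k+1]-tuple, 6 a vertex of [C - v], and 7 is 1 plus the index of a solved tuple
   for its component, or 0.  The cells of [e] and [x] are 1: the label of [x];
   2: the size of its component; 3: whether the component with label [x] is
   solved; 4: marks.  The word at [eBase] is set when a component of [C - v] has
   no solved tuple.  Counter 1 holds a sum over the options, counter 2 a product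
   over the components, and counter 0 the result. *)
Definition eInSep : expr :=
  eAny (fun j => Eqb (eProj (eDig (Var 0) j)) (Var 1)) (fun=> Cst 1) (iota 0 k).

Definition eConflict : expr :=
  Cond (Ltb eM (Var 4))
    (eAny (fun j => Cond (Ltb eM (eDig (Var 0) j))
                      (eG (sub (eDig (Var 0) j) eM1) (sub (Var 4) eM1)) (Cst 0))
       (fun=> Cst 1) (iota 0 k))
    (Cst 0).

(** Equal labels mean that deleting digit [i] would let the component of vertex 6 absorb the deleted
    vertex, so that the entry reached would describe another component. *)
Definition eUsable (i : nat) : expr :=
  Cond (Eqb (eLabel (eDrop (Var 5) i) (Var 6))
            (eLabel (eDrop (Var 5) i) (eProj (eDig (Var 5) i))))
    (Cst 0)
    (Mem (eCell 3 (eDrop (Var 5) i) (eLabel (eDrop (Var 5) i) (Var 6)))).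

Definition eFind : expr :=
  eAny eUsable (fun i => add (eDrop (Var 5) i) (Cst 1)) (iota 0 k.+1).

Definition p_mark : stmt :=
  Ite (Cond (Ltb (eLabel (Var 0) (Var 2)) eM) (eH (Var 1) (Var 2)) (Cst 0))
    (Store (eCell 4 (Var 0) (eLabel (Var 0) (Var 2))) (add (Var 1) (Cst 1)))
    Nop.

Definition p_relabel : stmt :=
  Ite (Eqb (Mem (eCell 4 (Var 0) (eLabel (Var 0) (Var 2)))) (add (Var 1) (Cst 1)))
    (Store (eCell 1 (Var 0) (Var 2)) (Var 1))
    Nop.

(* The vertices are inserted one by one; the new vertex [i] merges the components
   of its neighbours.  The mark [i + 1] is new at each step, so that marks need
   not be cleared. *)
Definition p_insert : stmt :=
  Ite eInSep (Store (eCell 1 (Var 0) (Var 1)) eM)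
    (Sq (For 2 (Var 1) p_mark)
      (Sq (For 2 (Var 1) p_relabel) (Store (eCell 1 (Var 0) (Var 1)) (Var 1)))).

Definition p_size : stmt :=
  Ite (Eqb (eLabel (Var 0) (Var 2)) (eLabel (Var 0) (Var 1)))
    (Store (eCell 2 (Var 0) (Var 1)) (add (Mem (eCell 2 (Var 0) (Var 1))) (Cst 1)))
    Nop.

Definition p_components : stmt :=
  Sq (For 1 eM p_insert)
    (Sq (Store (eCell 1 (Var 0) eM) eM) (For 1 eM (For 2 eM p_size))).

(** A usable tuple is sought before the test for a representative, because no labels are stored for
    tuples of [k.+1] digits: the label in the tuple found takes their place. *)
Definition p_factor : stmt :=
  Ite (Cond (Eqb (Var 6) (Var 1)) (Cst 0)
         (Eqb (eLabel (Var 0) (Var 6)) (eLabel (Var 0) (Var 1))))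
    (Let 7 eFind
      (Ite (Var 7)
         (Ite (Eqb (eLabel (sub (Var 7) (Cst 1)) (Var 6)) (Var 6))
            (CTimes (Cst 2) (Cst 2) (eCount (sub (Var 7) (Cst 1)) (Var 6)))
            Nop)
         (Store eBase (Cst 1))))
    Nop.

Definition p_option : stmt :=
  Ite (Eqb (eProj (Var 4)) (Var 1))
    (Let 5 (add (Var 0) (mul (Var 4) (ePow k)))
      (Sq (CSet (Cst 2) 1)
        (Sq (For 6 eM p_factor)
          (Ite eConflict Nop (CPlus (Cst 1) (Cst 1) (Cst 2))))))
    Nop.

(** Counters have no copy instruction; the target is cleared and counter 1 added to it. *)
Definition p_record : stmt :=
  Ite (Mem eBase) Nop
    (Sq (Store (eCell 3 (Var 0) (eLabel (Var 0) (Var 1))) (Cst 1))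
      (Sq (CSet (eCount (Var 0) (eLabel (Var 0) (Var 1))) 0)
        (CPlus (eCount (Var 0) (eLabel (Var 0) (Var 1)))
           (eCount (Var 0) (eLabel (Var 0) (Var 1))) (Cst 1)))).

Definition p_try : stmt :=
  Ite (Cond (Ltb (eLabel (Var 0) (Var 1)) eM)
         (Eqb (Mem (eCell 2 (Var 0) (Var 1))) (Var 3)) (Cst 0))
    (Sq (Store eBase (Cst 0)) (Sq (CSet (Cst 1) 0) (Sq (For 4 eB p_option) p_record)))
    Nop.

Definition p_final : stmt :=
  Ite (Eqb (eLabel (Var 0) (Var 6)) (Var 6))
    (CTimes (Cst 0) (Cst 0) (eCount (Var 0) (Var 6)))
    Nop.

Definition program : stmt :=
  Sq (For 0 (ePow k) p_components)
    (Sq (For 3 eM1 (For 0 (ePow k) (For 1 eM p_try)))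
      (Let 0 eNull (Sq (CSet (Cst 0) 1) (For 6 eM p_final)))).

End Program.


(** * Memory layout and evaluation of the expressions *)

Lemma nth_pairs (T1 T2 : Type) (f : T1 -> T2 -> nat) (x1 : T1) (x2 : T2) s1 s2 i j d :
  i < size s1 -> j < size s2 ->
  nth d [seq f x y | x <- s1, y <- s2] (i * size s2 + j) = f (nth x1 s1 i) (nth x2 s2 j).
Proof.
elim: s1 i => [|x s1 IH] [|i] //= i_lt j_lt; rewrite nth_cat size_map.
  by rewrite j_lt (nth_map x2).
by rewrite ifN; [rewrite mulSn -addnA addKn IH | rewrite mulSn; lia].
Qed.

Section Eval.
Variables (k n m : nat) (G : sgraph 'I_n) (H : sgraph 'I_m) (psi : 'I_n -> 'I_m).
Notation nopt := (nopt n m).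
Notation dig := (dig nopt).
Notation drop_dig := (drop_dig nopt).
Notation proj := (proj psi).

Definition base : nat := 2 + n + n * n + m * m.

Lemma baseE : base = 2 + n + n * n + m * m. Proof. by []. Qed.

Definition cell (f a x : nat) : nat := base + f + 4 * (a * (m + 1) + x).

Definition count_cell (a x : nat) : nat := 3 + (a * (m + 1) + x).

Lemma count_cell_ge3 a x : 3 <= count_cell a x. Proof. exact: leq_addr. Qed.

Record input_at (M : nat -> nat) : Prop := InputAt {
  input_n : M 0 = n;
  input_m : M 1 = m;
  input_psi : forall u : 'I_n, M (2 + u) = psi u;
  input_G : forall u w : 'I_n, M (2 + n + u * n + w) = G u w;
  input_H : forall x y : 'I_m, M (2 + n + n * n + x * m + y) = H x y
}.

Lemma encode_input : input_at (nth 0 (encode G H psi)).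
Proof.
rewrite /encode; split=> //.
- by move=> u; rewrite /= add0n nth_cat size_map size_enum_ord ltn_ord (nth_map u)
  ?nth_ord_enum ?size_enum_ord.
- move=> u w; rewrite -!addnA /= nth_cat size_map size_enum_ord ifN; last by lia.
  rewrite add0n addKn nth_cat size_allpairs !size_enum_ord ifT; last first.
    by have := ltn_ord u; have := ltn_ord w; nia.
  have := @nth_pairs _ _ (fun a b => nat_of_bool (G a b)) u w (enum 'I_n) (enum 'I_n) u w 0.
  by rewrite !size_enum_ord !ltn_ord !nth_ord_enum; apply.
- move=> x y; rewrite -!addnA /= nth_cat size_map size_enum_ord ifN; last by lia.
  rewrite add0n addKn nth_cat size_allpairs !size_enum_ord ifN; last by lia.
  rewrite addKn; have := @nth_pairs _ _ (fun a b =>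
    nat_of_bool (H a b)) x y (enum 'I_m) (enum 'I_m) x y 0.
  by rewrite !size_enum_ord !ltn_ord !nth_ord_enum; apply.
Qed.

Lemma encode_size : size (encode G H psi) = base.
Proof. by rewrite /= !size_cat size_map !size_allpairs !size_enum_ord /base !addnA. Qed.

Lemma encode_le a : m <= n -> nth 0 (encode G H psi) a <= n.
Proof.
move=> mn; have [lt_a|/(nth_default 0)->//] := ltnP a (size (encode G H psi)).
(* A matrix entry is a bit, and 1 is at most [n] since some vertex indexes the entry. *)
have sub1 (b : bool) u : u < n -> b <= n by case: b; lia.
move/(mem_nth 0): lt_a; rewrite /encode !inE !mem_cat.
case/or3P => [/eqP->//|/eqP->//|/or3P[/mapP[u _ ->]|/allpairsP[[u w] /= [_ _ ->]]|]].
- exact: leq_trans (ltnW (ltn_ord (psi u))) mn.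
- exact: sub1 (ltn_ord u).
- by case/allpairsP => [[x y] /= [_ _ ->]]; apply: sub1 (leq_trans (ltn_ord x) mn).
Qed.

(** The offsets 1 to 4 are distinct modulo 4, and [x <= m] makes [a] a quotient by [m + 1]. *)
Lemma cell_inj f a x f' a' x' : 0 < f <= 4 -> 0 < f' <= 4 -> x <= m -> x' <= m ->
  (cell f a x == cell f' a' x') = [&& f == f', a == a' & x == x'].
Proof.
move=> f4 f4' xm xm'; apply/eqP/and3P => [|[/eqP-> /eqP-> /eqP->]] //.
rewrite /cell => eq4; have [eqf eqax] : f = f' /\ a * (m + 1) + x = a' * (m + 1) + x'.
  by move: (a * _) (a' * _) eq4; lia.
have eqa : a = a'.
  have := congr1 (divn^~ (m + 1)) eqax.
  by rewrite !divnMDl ?addn1 // !divn_small ?ltnS // !addn0.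
by move: eqax; rewrite eqf eqa => /addnI->.
Qed.

Lemma count_cell_inj a x a' x' : x <= m -> x' <= m ->
  (count_cell a x == count_cell a' x') = (a == a') && (x == x').
Proof.
move=> xm xm'; have := @cell_inj 1 a x 1 a' x' isT isT xm xm'.
by rewrite /cell /count_cell !eqn_add2l eqn_pmul2l.
Qed.

Lemma mset_cell M f a x v f' a' x' : 0 < f <= 4 -> 0 < f' <= 4 -> x <= m -> x' <= m ->
  mset M (cell f a x) v (cell f' a' x') =
  if [&& f' == f, a' == a & x' == x] then v else M (cell f' a' x').
Proof. by move=> *; rewrite /mset /= cell_inj. Qed.

Lemma mset_count C a x v a' x' : x <= m -> x' <= m ->
  mset C (count_cell a x) v (count_cell a' x') =
  if (a' == a) && (x' == x) then v else C (count_cell a' x').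
Proof. by move=> *; rewrite /mset /= count_cell_inj. Qed.

Lemma input_mset M a v : base <= a -> input_at M -> input_at (mset M a v).
Proof.
rewrite /base => ba [In Im Ipsi IG IH]; split.
- by rewrite /mset /= ifN //; lia.
- by rewrite /mset /= ifN //; lia.
- by move=> u; rewrite /mset /= ifN //; have := ltn_ord u; lia.
- move=> u w; rewrite /mset /= ifN //; have := ltn_ord u; have := ltn_ord w; nia.
- move=> x y; rewrite /mset /= ifN //; have := ltn_ord x; have := ltn_ord y; nia.
Qed.

Lemma cell_neq_base f a x : 0 < f -> cell f a x != base.
Proof. by rewrite /cell; lia. Qed.

Lemma base_cell f a x : base <= cell f a x.
Proof. by rewrite /cell -addnA leq_addr. Qed.

Section EvalMacros.
Variables (r M : nat -> nat).
Hypothesis inM : input_at M.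

Lemma eval_M : eval r M eM = m. Proof. exact: input_m inM. Qed.
Lemma eval_M1 : eval r M eM1 = m.+1. Proof. by rewrite /= (input_m inM) addn1. Qed.
Lemma eval_B : eval r M eB = nopt.
Proof. by rewrite /= (input_m inM) (input_n inM) addn1. Qed.
Lemma eval_base : eval r M eBase = base.
Proof. by rewrite /= (input_m inM) (input_n inM). Qed.
Lemma eval_cell f a x : eval r M (eCell f a x) = cell f (eval r M a) (eval r M x).
Proof. by rewrite /= (input_m inM) (input_n inM). Qed.
Lemma eval_label a x : eval r M (eLabel a x) = M (cell 1 (eval r M a) (eval r M x)).
Proof. by rewrite -eval_cell. Qed.
Lemma eval_count a x : eval r M (eCount a x) = count_cell (eval r M a) (eval r M x).
Proof. by rewrite /= (input_m inM). Qed.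
Lemma eval_pow j : eval r M (ePow j) = nopt ^ j.
Proof. by elim: j => //= j IH; rewrite expnS -IH -eval_B. Qed.
Lemma eval_dig e j : eval r M (eDig e j) = dig (eval r M e) j.
Proof. by rewrite /dig -eval_pow -eval_B. Qed.
Lemma eval_drop e i : eval r M (eDrop e i) = drop_dig (eval r M e) i.
Proof. by rewrite /drop_dig -!eval_pow. Qed.
Lemma eval_proj o : eval r M o < nopt -> eval r M (eProj o) = proj (eval r M o).
Proof.
move=> oB; rewrite /proj /= (input_m inM) lt0b addn1.
case: ltnP => //= mo; have lt_n : eval r M o - m.+1 < n by move: oB; rewrite noptE; lia.
have := input_psi inM (Ordinal lt_n); rewrite -(psinE psi (Ordinal lt_n)) /= => <-.
by congr (M _).
Qed.
Lemma eval_proj_dig e j : eval r M (eProj (eDig e j)) = proj (dig (eval r M e) j).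
Proof. by rewrite eval_proj eval_dig // dig_lt. Qed.
Lemma eval_H x y (x' y' : 'I_m) : eval r M x = x' -> eval r M y = y' ->
  eval r M (eH x y) = H x' y'.
Proof. by move=> Dx Dy; rewrite /= Dx Dy (input_n inM) (input_m inM) (input_H inM). Qed.
Lemma eval_G u w (u' w' : 'I_n) : eval r M u = u' -> eval r M w = w' ->
  eval r M (eG u w) = G u' w'.
Proof. by move=> Du Dw; rewrite /= Du Dw (input_n inM) (input_G inM). Qed.


End EvalMacros.

Opaque eN eM eM1 eB eBase eCell eLabel eCount ePow eDig eDrop eProj eG eH.

Section EvalQueries.
Variables (r M : nat -> nat).
Hypothesis inM : input_at M.

Lemma eval_anyP c v s :
  [\/ (forall j, j \in s -> eval r M (c j) = 0) /\ eval r M (eAny c v s) = 0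
    | exists j, [/\ j \in s, 0 < eval r M (c j) & eval r M (eAny c v s) = eval r M (v j)]].
Proof.
elim: s => [|j s IHs] /=; first by left.
case: ifPn => cj; first by right; exists j; rewrite inE eqxx.
case: IHs => [[c0 ->]|[i [i_s ci ->]]].
  left; split=> // i; rewrite inE => /orP[/eqP->|]; last exact: c0.
  by move: cj; case: (eval r M (c j)).
by right; exists i; rewrite inE i_s orbT.
Qed.

Lemma eval_any c s : eval r M (eAny c (fun=> Cst 1) s) =
  has (fun j => 0 < eval r M (c j)) s.
Proof. by elim: s => //= j s ->; case: (0 < _). Qed.

Lemma eval_inSep (x : 'I_m) : r 1 = x -> eval r M (eInSep k) = (x \in sep psi k (r 0)).
Proof.
move=> Dx; rewrite /eInSep eval_any; congr nat_of_bool; apply/hasP/sepP.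
  case=> j; rewrite mem_iota => jk; rewrite /= (eval_proj_dig _ inM) Dx.
  by rewrite lt0b => /eqP; exists j.
case=> j jk jx; exists j; first by rewrite mem_iota.
by rewrite /= (eval_proj_dig _ inM) jx Dx eqxx.
Qed.

Lemma eval_conflict : r 4 < nopt ->
  eval r M (eConflict k) = ~~ compatible m G k (r 0) (r 4).
Proof.
move=> gB; rewrite /eConflict /= (eval_M _ inM) lt0b; case: ltnP => [mg|gm]; last first.
  rewrite (_ : compatible _ _ _ _ _) //; apply/forall_inP => u _; apply/forallP => w.
  by apply/implyP => /eqP Dg; move: gm; rewrite Dg; lia.
have lt_g : r 4 - m.+1 < n by move: gB; rewrite /nopt; lia.
have lt_o j : dig (r 0) j - m.+1 < n.
  by have := @dig_lt nopt isT (r 0) j; rewrite /nopt; lia.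
have cE j : eval r M (Cond (Ltb eM (eDig (Var 0) j))
    (eG (sub (eDig (Var 0) j) eM1) (sub (Var 4) eM1)) (Cst 0)) =
    (m < dig (r 0) j) && G (Ordinal (lt_o j)) (Ordinal lt_g).
  rewrite /= (eval_M _ inM) (eval_dig _ inM) /= lt0b; case: ltnP => //= mo.
  by rewrite (@eval_G _ _ inM _ _ (Ordinal (lt_o j)) (Ordinal lt_g)) //= ?(eval_dig _ inM)
    (eval_M1 _ inM).
rewrite eval_any; congr nat_of_bool; apply/hasP/idP.
  case=> j; rewrite mem_iota cE lt0b => jk /andP[mo Gog].
  apply/negP => /forall_inP/(_ (Ordinal (lt_o j))) nG.
  have {}nG : [forall w : 'I_n, (r 4 == m.+1 + w) ==> ~~ G (Ordinal (lt_o j)) w].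
    by apply: nG; apply/chosenP; exists j => //=; lia.
  by move/forallP/(_ (Ordinal lt_g)): nG; rewrite Gog implybF => /eqP; apply => /=; lia.
rewrite /compatible => /forall_inPn[u /chosenP[j jk Dj]] /forallPn[w].
rewrite negb_imply negbK => /andP[/eqP Dg Guw].
exists j; first by rewrite mem_iota.
rewrite cE lt0b; apply/andP; split; first by rewrite Dj; lia.
suff [-> ->] : Ordinal (lt_o j) = u /\ Ordinal lt_g = w by [].
by split; apply: val_inj => /=; lia.
Qed.

End EvalQueries.

End Eval.

#[global] Opaque eN eM eM1 eB eBase eCell eLabel eCount ePow eDig eDrop eProj eG eH eInSep
  eConflict eFind.

(** * Computing the components *)

Section Insertion.
Variables (m : nat) (H : rel 'I_m) (S : {set 'I_m}).
Hypothesis H_sym : symmetric H.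

Definition upto (i : nat) : rel 'I_m :=
  [rel x y | [&& H x y, x \notin S, y \notin S & (x < i) && (y < i)]].

(** Outside [S] the label is forced to be the largest vertex of the component: it is constant along
    edges, belongs to the component and bounds every member. *)
Definition labels_ok (i : nat) (l : nat -> nat) : Prop :=
  [/\ forall y : 'I_m, y < i -> y \in S -> l y = m,
      forall y : 'I_m, y < i -> y \notin S ->
        exists z : 'I_m, [/\ l y = z, connect (upto i) y z, y <= z & z < i]
    & forall y z : 'I_m, upto i y z -> l y = l z].

Definition touched (i j : nat) (l : nat -> nat) (l0 : nat) : bool :=
  [exists x : 'I_m, exists z : 'I_m,
    [&& x == i :> nat, z < j, H x z, l z < m & l z == l0]].

Lemma upto_mono i j x y : i <= j -> upto i x y -> upto j x y.
Proof. by move=> ij /and4P[xy xS yS /andP[xi yi]]; apply/and5P; split=> //; lia. Qed.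

Lemma labels_ok0 l : labels_ok 0 l.
Proof. by split=> // y z /and4P[]. Qed.

Lemma labels_ok_sep (x : 'I_m) (l l' : nat -> nat) : x \in S -> labels_ok x l ->
  (forall y : 'I_m, y < x -> l' y = l y) -> l' x = m -> labels_ok x.+1 l'.
Proof.
move=> xS [lS lz lR] l'E l'x.
have lt_x (y : 'I_m) : y < x.+1 -> y \notin S -> y < x.
  rewrite ltnS leq_eqVlt => /orP[/eqP/val_inj->|//]; by rewrite xS.
split=> [y|y yx yS|y z /and4P[yz yS zS /andP[yx zx]]].
- rewrite ltnS leq_eqVlt => /orP[/eqP/val_inj->|yx]; first by [].
  by rewrite l'E //; apply: lS.
- have [z [Dz yz le_yz zx]] := lz y (lt_x y yx yS) yS.
  exists z; split=> //; [by rewrite l'E ?lt_x | | exact: ltnW].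
  by apply: connect_sub yz => a b ab; apply/connect1/upto_mono/ab.
- have {}yx := lt_x y yx yS; have {}zx := lt_x z zx zS.
  by rewrite !l'E //; apply: lR; apply/and5P.
Qed.

(** The new label [x] exceeds all earlier vertices, so labels remain maxima. A relabelled vertex
    reaches [x] through a neighbour of [x] with the same old label. *)
Lemma labels_ok_insert (x : 'I_m) (l l' : nat -> nat) : x \notin S -> labels_ok x l ->
  (forall y : 'I_m, y < x -> l' y = if touched x x l (l y) then val x else l y) ->
  l' x = x -> labels_ok x.+1 l'.
Proof.
move=> xS [lS lz lR] l'E l'x.
have lift (a b : 'I_m) : connect (upto x) a b -> connect (upto x.+1) a b.
  by apply: connect_sub => c d cd; apply/connect1/upto_mono/cd.
have l_lt (y : 'I_m) : y < x -> y \notin S -> l y < m.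
  by move=> yx yS; have [z [-> _ _ _]] := lz y yx yS.
have sym a b : connect (upto x.+1) a b = connect (upto x.+1) b a.
  apply: sym_connect_sym => c d; rewrite /upto /= H_sym; congr (_ && _).
  by rewrite andbC -andbA; congr (_ && _); rewrite andbC [(d < _) && _]andbC -?andbA.
split=> [y|y|y z /and4P[yz yS zS /andP[]]].
- rewrite ltnS leq_eqVlt => /orP[/eqP/val_inj->|yx yS]; first by rewrite (negPf xS).
  rewrite l'E // lS //; case: ifP => // /existsP[x' /existsP[z]].
  by case/and5P=> _ _ _ + /eqP lzm; rewrite lzm ltnn.
- rewrite ltnS leq_eqVlt => /orP[/eqP/val_inj->|yx yS]; first by exists x.
  rewrite l'E //; case: ifP => [/existsP[x' /existsP[z]]|_].
    case/and5P=> /eqP/val_inj -> zx xz lzm /eqP eql.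
    exists x; split=> //; last exact: ltnW.
    have zS : z \notin S by apply/negP => zS; rewrite lS ?ltnn in lzm.
    have [y' [Dy yy' _ _]] := lz y yx yS; have [z' [Dz zz' _ _]] := lz z zx zS.
    have eqz : y' = z' by apply: val_inj; rewrite /= -Dy -Dz.
    apply: connect_trans (lift _ _ yy') _; rewrite eqz.
    rewrite sym; apply: connect_trans (lift _ _ zz'); apply: connect1.
    by apply/and5P; split; rewrite // ltnW.
  have [z [Dz yz le_yz zx]] := lz y yx yS.
  by exists z; split=> //; [exact: lift | exact: ltnW].
have toN (c : 'I_m) : c < x -> c \notin S -> H x c -> l' c = x.
  move=> cx cS xc; rewrite l'E // ifT //; apply/existsP; exists x; apply/existsP; exists c.
  by rewrite !eqxx cx xc l_lt.
rewrite !ltnS leq_eqVlt => /orP[/eqP/val_inj y_x|yx]; rewrite leq_eqVlt =>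
  /orP[/eqP/val_inj z_x|zx].
- by rewrite y_x z_x.
- by rewrite y_x l'x toN // -y_x.
- by rewrite z_x l'x toN // H_sym -z_x.
- by rewrite !l'E // (lR y z) //; apply/and5P.
Qed.

Lemma labels_ok_rep l (x : 'I_m) : labels_ok m l -> x \notin S ->
  l x = rep [rel a b | [&& H a b, a \notin S & b \notin S]] x.
Proof.
move=> [_ lz lR] xS; have eqR a b : upto m a b = [&& H a b, a \notin S & b \notin S].
  by rewrite /upto /= !ltn_ord !andbT.
set R := [rel _ _ | _]; have [z [Dx xz _ _]] := lz x (ltn_ord x) xS.
have {}xz : connect R x z by rewrite -(eq_connect eqR).
rewrite Dx; apply/esym/rep_unique => // y xy.
have yS : y \notin S.
  by rewrite -(connect_invariant (f := fun c => c \notin S) _ xy) // => a b /and3P[_ -> ->].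
have [y' [Dy _ yy' _]] := lz y (ltn_ord y) yS.
suff <- : y' = z by [].
apply: val_inj; rewrite /= -Dy -Dx; apply/esym.
by apply: (connect_invariant (f := fun c => l (val c)) _ xy) => c d cd; apply: lR;
  rewrite eqR.
Qed.

End Insertion.

Section Phase1.
Variables (k n m : nat) (G : sgraph 'I_n) (H : sgraph 'I_m) (psi : 'I_n -> 'I_m).
Variables (D W : nat).
Hypotheses (le_mn : m <= n) (leW : n.+2 ^ D <= W).
Notation post := (post n.+2 D W).
Notation nopt := (nopt n m).
Notation sep := (sep psi k).
Notation label := (label H psi k).
Notation cell := (cell n m).
Notation input_at := (input_at G H psi).
Notation post_for_unif := (post_for_unif (isT : 1 < n.+2) leW).
Notation post_ite_sum := (post_ite_sum (isT : 1 < n.+2) leW).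
Notation post_store := (post_store (isT : 1 < n.+2) leW).
Notation post_seq := (post_seq (isT : 1 < n.+2) leW).
Notation post_let := (post_let (isT : 1 < n.+2) leW).

Lemma touchedS (i z : 'I_m) l x :
  touched H i z.+1 l x = touched H i z l x || [&& H i z, l z < m & l z == x].
Proof.
apply/existsP/orP => [[i' /existsP[z' /and5P[/eqP/val_inj-> zz' h1 h2 h3]]]|].
  move: zz'; rewrite ltnS leq_eqVlt => /orP[/eqP/val_inj Dz|zz'].
    by right; rewrite -Dz h1 h2.
  by left; apply/existsP; exists i; apply/existsP; exists z'; rewrite eqxx zz' h1 h2.
case=> [/existsP[i' /existsP[z' /and5P[ii' zz' h1 h2 h3]]]|/and3P[h1 h2 h3]].
  by exists i'; apply/existsP; exists z'; rewrite ii' ltnW // h1 h2.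
by exists i; apply/existsP; exists z; rewrite eqxx ltnSn h1 h2.
Qed.

Section Index.
Variables (a : nat) (r : nat -> nat).
Hypothesis r0 : r 0 = a.

Section Insert.
Variable i : 'I_m.
Hypothesis r1 : r 1 = i.

Lemma post_marks M C : input_at M -> (forall y, y < i -> M (cell 1 a y) <= m) ->
  post (For 2 (Var 1) p_mark) r M C (2 + 2 + i * (scost p_mark + 3)) (fun M' C' =>
    input_at M' /\ forall f b x, 0 < f <= 4 -> x <= m -> M' (cell f b x) =
      if [&& f == 4, b == a & touched H i i (fun y => M (cell 1 a y)) x]
      then i.+1 else M (cell f b x)).
Proof.
move=> inM labM; pose l y := M (cell 1 a y).
pose I z (M' C' : nat -> nat) := input_at M' /\ forall f b x, 0 < f <= 4 -> x <= m ->
  M' (cell f b x) = if [&& f == 4,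
    b == a & touched H i z l x] then i.+1 else M (cell f b x).
rewrite -r1; apply: (post_for_unif (I := I)) => [|z M' C'|M' C'].
- split=> // f b x _ _; rewrite ifN // !negb_and; apply/orP; right; apply/orP; right.
  by apply/existsPn => i'; apply/existsPn => z; rewrite ltn0 andbF.
- rewrite /= r1 => z_lt [inM' M'E].
  have zm : z < m by apply: ltn_trans (ltn_ord i).
  have lz_le : l z <= m by apply: labM.
  have lab : eval (upd r 2 z) M' (eLabel (Var 0) (Var 2)) = l z.
    by rewrite (eval_label _ inM') /= r0 M'E //; lia.
  have cnd : eval (upd r 2 z) M'
      (Cond (Ltb (eLabel (Var 0) (Var 2)) eM) (eH (Var 1) (Var 2)) (Cst 0)) =
      (l z < m) && H i (Ordinal zm).
    rewrite /= lab (eval_M _ inM') lt0b; case: ltnP => //= _.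
    by rewrite (eval_H inM' (x' := i) (y' := Ordinal zm)) /= ?r1.
  apply: post_ite_sum; rewrite cnd => Dc.
    apply: post_store; rewrite /= r1 addn1; first by have := ltn_ord i; lia.
    rewrite (eval_cell _ inM') lab /= r0; split;
      first exact: input_mset (base_cell _ _ _ _ _) inM'.
    move=> f b x f4 xm; rewrite mset_cell // M'E //.
    have -> : touched H i z.+1 l x = touched H i z l x || (l z == x).
      have /andP[lzm Hiz] : (l z < m) && H i (Ordinal zm) by move: Dc; rewrite lt0b.
      by rewrite (touchedS i (Ordinal zm)) /= lzm Hiz.
    rewrite [x == l z]eq_sym; case: eqP => // _; case: eqP => // _ /=.
    by case: (l z == x); rewrite ?orbT ?orbF.
  apply: post_nop; split=> // f b x f4 xm; rewrite M'E //.
  have -> // : touched H i z.+1 l x = touched H i z l x.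
  rewrite (touchedS i (Ordinal zm)) /= andbCA andbA -[(l z < m) && _]andbC.
  by case: (H _ _) (l z < m) Dc => [] [] //=; rewrite ?orbF.
- by rewrite /= r1.
Qed.

(** Relabelling in place is harmless: each turn reads only the label of its own vertex, not yet
    overwritten, and a mark, which this loop never changes. *)
Lemma post_relabel M C : input_at M -> (forall y, y < i -> M (cell 1 a y) <= m) ->
  post (For 2 (Var 1) p_relabel) r M C (2 + 2 + i * (scost p_relabel + 3)) (fun M' C' =>
    input_at M' /\ forall f b x, 0 < f <= 4 -> x <= m -> M' (cell f b x) =
      if [&& f == 1, b == a, x < i & M (cell 4 a (M (cell 1 a x))) == i.+1]
      then val i else M (cell f b x)).
Proof.
move=> inM labM.
pose I y (M' C' : nat -> nat) := input_at M' /\ forall f b x, 0 < f <= 4 -> x <= m ->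
  M' (cell f b x) = if [&& f == 1, b == a, x < y & M (cell 4 a (M (cell 1 a x))) == i.+1]
      then val i else M (cell f b x).
rewrite -r1; apply: (post_for_unif (I := I)) => [|y M' C'|M' C'].
- by split=> // f b x _ _; rewrite ltn0 !andbF.
- rewrite /= r1 => y_lt [inM' M'E].
  have ym : y < m by apply: ltn_trans (ltn_ord i).
  have lab : eval (upd r 2 y) M' (eLabel (Var 0) (Var 2)) = M (cell 1 a y).
    by rewrite (eval_label _ inM') /= r0 M'E ?ltnn ?andbF //; lia.
  have cnd : eval (upd r 2 y) M' (Eqb (Mem (eCell 4 (Var 0) (eLabel (Var 0) (Var 2))))
      (add (Var 1) (Cst 1))) = (M (cell 4 a (M (cell 1 a y))) == i.+1).
    by rewrite /= (eval_cell _ inM') lab /= r0 r1 addn1 M'E ?labM.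
  apply: post_ite_sum; rewrite cnd => Dc.
    apply: post_store; rewrite /= r1; first by have := ltn_ord i; lia.
    rewrite (eval_cell _ inM') /= r0; split;
      first exact: input_mset (base_cell _ _ _ _ _) inM'.
    move=> f b x f4 xm; rewrite mset_cell ?(ltnW ym) // M'E // ltnS [x <= y]leq_eqVlt.
    case: eqP => // _; case: eqP => // _ /=; case: eqP => [->|//].
    by move: Dc; rewrite lt0b => ->.
  apply: post_nop; split=> // f b x f4 xm; rewrite M'E // ltnS [x <= y]leq_eqVlt.
  case: eqP => // _; case: eqP => // _ /=; have [->|//] := eqVneq x y.
  by case: eqP Dc; rewrite ?andbF.
- by rewrite /= r1.
Qed.

Definition insert_cost : nat := ecost (eInSep k) + 2 +
  (scost (Store (eCell 1 (Var 0) (Var 1)) eM) + (2 + 2 + m * (scost p_mark + 3) +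
    (2 + 2 + m * (scost p_relabel + 3) + scost (Store (eCell 1 (Var 0) (Var 1)) (Var 1))))).

Definition insert_inv (M0 : nat -> nat) (j : nat) (M C : nat -> nat) : Prop :=
  [/\ input_at M,
      forall f b x, 0 < f <= 4 -> x <= m -> [|| b != a, f == 2 | f == 3] ->
        M (cell f b x) = M0 (cell f b x),
      forall x, x <= m -> M (cell 4 a x) <= j
    & labels_ok H (sep a) j (fun y => M (cell 1 a y))].

Lemma post_insert M0 M C : insert_inv M0 i M C ->
  post (p_insert k) r M C insert_cost (insert_inv M0 i.+1).
Proof.
case=> inM frame marks lok.
have labM y : y < i -> M (cell 1 a y) <= m.
  move=> yi; have ym : y < m by apply: ltn_trans (ltn_ord i).
  case: lok => lS lz _; have [yS|yS] := boolP (Ordinal ym \in sep a).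
    by have /= -> := lS (Ordinal ym) yi yS.
  by have [z /= [-> _ _ _]] := lz (Ordinal ym) yi yS; apply: ltnW.
have im := ltnW (ltn_ord i).
apply: post_ite_sum; rewrite (eval_inSep k inM (x := i)) // r0 => iS.
  apply: post_store; rewrite (eval_M _ inM); first lia.
  rewrite (eval_cell _ inM) /= r0 r1; split.
  - exact: input_mset (base_cell _ _ _ _ _) inM.
  - move=> f b x f4 xm fb; rewrite mset_cell //; case: ifP fb =>
    [/and3P[/eqP-> /eqP-> _]|_ fb]; last exact: frame.
    by rewrite eqxx.
  - by move=> x xm; rewrite mset_cell //=; apply: leqW; apply: marks.
  - apply: labels_ok_sep lok _ _; first by move: iS; rewrite lt0b.
      by move=> y yi; rewrite mset_cell ?(ltnW (ltn_ord y)) //= eqxx /= ltn_eqF.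
    by rewrite mset_cell //= !eqxx.
apply: (post_seq (R := fun M' _ => input_at M' /\ forall f b x, 0 < f <= 4 -> x <= m ->
   M' (cell f b x) = if [&& f == 4, b == a & touched H i i (fun y => M (cell 1 a y)) x]
      then i.+1 else M (cell f b x))).
  apply: post_weaken (post_marks inM labM) => //.
  by rewrite leq_add2l leq_mul2r im orbT.
move=> M1 C1 [inM1 M1E].
have lab1 y : y <= m -> M1 (cell 1 a y) = M (cell 1 a y) by move=> ym; rewrite M1E.
apply: (post_seq (R := fun M' _ => input_at M' /\ forall f b x, 0 < f <= 4 -> x <= m ->
  M' (cell f b x) = if [&& f == 1, b == a, x < i & M1 (cell 4 a (M1 (cell 1 a x))) == i.+1]
      then val i else M1 (cell f b x))).
  apply: post_weaken (post_relabel inM1 _) => //.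
    by rewrite leq_add2l leq_mul2r im orbT.
  by move=> y yi; rewrite lab1 ?labM //; lia.
move=> M2 C2 [inM2 M2E].
apply: post_store; rewrite /= r1; first by lia.
rewrite (eval_cell _ inM2) /= r0 r1; split.
- exact: input_mset (base_cell _ _ _ _ _) inM2.
- move=> f b x f4 xm fb; rewrite mset_cell // M2E //.
  have f1 : (f == 1) && (b == a) = false by lia.
  have f4' : (f == 4) && (b == a) = false by lia.
  rewrite !andbA f1 /= M1E // andbA f4' /=.
  exact: frame.
- move=> x xm; rewrite mset_cell //= M2E //= M1E //=; case: ifP => // _.
  by apply: leqW; apply: marks.
- apply: (labels_ok_insert (@adj_sym _ H) _ lok); first by apply/negP => iS';
  rewrite iS' in iS.
    move=> y yi; have ym := ltnW (ltn_ord y).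
    rewrite mset_cell //= eqxx /= ltn_eqF // M2E //= eqxx yi /= lab1 // M1E ?labM //= eqxx
      /=.
    case: (touched _ _ _ _ _); first by rewrite eqxx.
    (* Marks from earlier insertions are at most [i], so they cannot be mistaken for [i.+1]. *)
    by rewrite ltn_eqF // ltnS marks ?labM.
  by rewrite mset_cell //= !eqxx.
Qed.

End Insert.

End Index.

Section Components.
Variables (a : nat) (r : nat -> nat).
Hypothesis r0 : r 0 = a.

Definition class_size (l : nat -> nat) (x : nat) : nat := \sum_(y < m) (l y == l x).

Lemma post_sizes M C : input_at M -> (forall x, x <= m -> M (cell 2 a x) = 0) ->
  post (For 1 eM (For 2 eM p_size)) r M C
    (ecost eM + 2 + m * (ecost eM + 2 + m * (scost p_size + 3) + 3)) (fun M' C' =>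
    input_at M' /\ forall f b x, 0 < f <= 4 -> x <= m -> M' (cell f b x) =
      if [&& f == 2, b == a & x < m] then class_size (fun y => M (cell 1 a y)) x
      else M (cell f b x)).
Proof.
move=> inM sz0; set l := fun y => M (cell 1 a y).
pose I x (M' C' : nat -> nat) := input_at M' /\ forall f b x', 0 < f <= 4 -> x' <= m ->
  M' (cell f b x') = if [&& f == 2,
    b == a & x' < x] then class_size l x' else M (cell f b x').
have := eval_M r inM => eM_m.
rewrite -{1}eM_m; apply: (post_for_unif (I := I)) => [|x M1 C1|M1 C1].
- by split=> // f b x _ _; rewrite ltn0 !andbF.
- rewrite eM_m => x_lt [inM1 M1E].
  pose J y (M' C' : nat -> nat) := input_at M' /\ forall f b x', 0 < f <= 4 -> x' <= m ->
    M' (cell f b x') = if [&& f == 2, b == a & x' == x]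
      then \sum_(0 <= y' < y) (l y' == l x : nat) else M1 (cell f b x').
  have eM_m1 := eval_M (upd r 1 x) inM1.
  rewrite -{1}eM_m1; apply: (post_for_unif (I := J)) => [|y M2 C2|M2 C2].
  + split=> // f b x' f4 xm; rewrite big_geq //.
    by case: ifP => // /and3P[/eqP-> /eqP-> /eqP->]; rewrite M1E ?ltnn ?andbF ?sz0 // ltnW.
  + rewrite eM_m1 => y_lt [inM2 M2E].
    have xm := ltnW x_lt; have ym := ltnW y_lt.
    have lab z : z <= m -> M2 (cell 1 a z) = l z by move=> zm; rewrite M2E //= M1E.
    have cnd : eval (upd (upd r 1 x) 2 y) M2
        (Eqb (eLabel (Var 0) (Var 2)) (eLabel (Var 0) (Var 1))) = (l y == l x).
      by rewrite /= !(eval_label _ inM2) /= r0 !lab.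
    apply: post_ite_sum; rewrite cnd => Dc.
      have lt_sz : \sum_(0 <= y' < y) (l y' == l x : nat) <= y.
        rewrite -[leqRHS]subn0 -[y - 0]muln1 -sum_nat_const_nat.
        by apply: leq_sum => z _; case: (_ == _).
      have val_sz : eval (upd (upd r 1 x) 2 y) M2 (add (Mem (eCell 2 (Var 0) (Var 1))) (Cst
        1)) =
          \sum_(0 <= y' < y.+1) (l y' == l x : nat).
        rewrite /= (eval_cell _ inM2) /= r0 M2E // !eqxx /= big_nat_recr //=.
        by congr (_ + _); move: Dc; case: (_ == _).
      apply: post_store; rewrite val_sz.
        rewrite big_nat_recr //=; move: lt_sz; case: (_ == _); lia.
      rewrite (eval_cell _ inM2) /= r0; split;
        first exact: input_mset (base_cell _ _ _ _ _) inM2.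
      by move=> f b x' f4 x'm; rewrite mset_cell //; case: ifP => // c; rewrite M2E // c.
    apply: post_nop; split=> // f b x' f4 x'm; rewrite M2E // big_nat_recr //= Dc addn0 //.
  + rewrite eM_m1 => -[inM2 M2E]; split=> // f b x' f4 x'm.
    rewrite M2E // M1E // ltnS [x' <= x]leq_eqVlt.
    case: eqP => //= _; case: eqP => //= _; case: eqP => //= ->.
    by rewrite /class_size big_mkord.
- by rewrite eM_m.
Qed.

Definition components_cost : nat :=
  ecost eM + 2 + m * (insert_cost + 3) + (scost (Store (eCell 1 (Var 0) eM) eM) +
    (ecost eM + 2 + m * (ecost eM + 2 + m * (scost p_size + 3) + 3))).

Definition tables (b : nat) (M : nat -> nat) : Prop :=
  (forall x, x <= m -> M (cell 1 b x) = label b x) /\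
  (forall x, x < m -> M (cell 2 b x) = class_size (label b) x).

(** Sizes are counted up from the content found in memory and marks must start below 1, so both have
    to be zero for the tuples still to come. *)
Definition components_inv (j : nat) (M C : nat -> nat) : Prop :=
  [/\ input_at M, forall b x, x <= m -> M (cell 3 b x) = 0,
     forall b x, j <= b -> x <= m -> M (cell 2 b x) = 0 /\ M (cell 4 b x) = 0
   & forall b, b < j -> tables b M].

Lemma post_components M C : components_inv a M C ->
  post (p_components k) r M C components_cost (components_inv a.+1).
Proof.
case=> inM good0 fresh tab.
have eM_m := eval_M r inM.
apply: (post_seq (R := insert_inv a M m)).
  rewrite -{1}eM_m; apply: (post_for_unif (I := insert_inv a M)) => [|i M' C'|M' C'].
  - split=> // [x xm|]; last exact: labels_ok0.
    by case: (fresh a x (leqnn a) xm) => _ ->.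
  - rewrite eM_m => i_lt; exact: (@post_insert a (upd r 1 i) r0 (Ordinal i_lt)).
  - by rewrite eM_m.
move=> M1 C1 [inM1 frame1 _ lok1].
have lab1 x : x < m -> M1 (cell 1 a x) = label a x.
  move=> x_lt; have [xS|xS] := boolP (Ordinal x_lt \in sep a).
    by case: lok1 => /(_ (Ordinal x_lt) x_lt xS) /= -> _ _;
      rewrite -[x]/(val (Ordinal x_lt)) label_sep.
  have /= := labels_ok_rep lok1 xS => ->.
  by rewrite -[x in RHS]/(val (Ordinal x_lt)) labelE.
pose R M' (C' : nat -> nat) := input_at M' /\ forall f b x, 0 < f <= 4 -> x <= m ->
  M' (cell f b x) = if [&& f == 1, b == a & x == m] then m else M1 (cell f b x).
apply: (post_seq (R := R)).
  apply: post_store; rewrite (eval_M _ inM1); first by lia.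
  rewrite (eval_cell _ inM1) (eval_M _ inM1) /= r0; split.
    exact: input_mset (base_cell _ _ _ _ _) inM1.
  by move=> f b x f4 xm; rewrite mset_cell.
move=> M2 C2 [inM2 M2E].
have lab2 x : x <= m -> M2 (cell 1 a x) = label a x.
  move=> xm; rewrite M2E //= eqxx /=; case: eqP => [->|/eqP xm']; first by rewrite label_m.
  by apply: lab1; rewrite ltn_neqAle xm'.
have z2 x : x <= m -> M2 (cell 2 a x) = 0.
  move=> xm; rewrite M2E //= frame1 ?orbT //.
  by case: (fresh a x (leqnn a) xm).
apply: post_weaken (post_sizes inM2 z2) => // M3 C3 [inM3 M3E].
have cls x : x < m -> class_size (fun y => M2 (cell 1 a y)) x = class_size (label a) x.
  by move=> xm; apply: eq_bigr => y _; rewrite !lab2 // ltnW.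
have other f b x : 0 < f <= 4 -> b != a -> x <= m -> M3 (cell f b x) = M (cell f b x).
  move=> f4 /negPf ba xm; have nba : b != a by rewrite ba.
  by rewrite M3E // ba !andbF M2E // ba !andbF frame1 ?nba.
split=> //.
- by move=> b x xm; rewrite M3E //= M2E //= frame1 ?orbT ?good0.
- move=> b x ab xm; have ba : b != a by lia.
  by rewrite !other //; apply: fresh; rewrite // ltnW.
- move=> b; rewrite ltnS leq_eqVlt => /orP[/eqP->|ba].
    split=> x xm; first by rewrite M3E //= lab2.
    by rewrite M3E ?(ltnW xm) //= eqxx xm cls.
  have [t1 t2] := tab b ba; split=> x xm; first by rewrite other ?t1 // ltn_eqF.
  by rewrite other ?t2 ?(ltnW xm) // ltn_eqF.
Qed.

End Components.

Lemma post_phase1 r M C : components_inv 0 M C ->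
  post (For 0 (ePow k) (p_components k)) r M C
    (ecost (ePow k) + 2 + nopt ^ k * (components_cost + 3)) (components_inv (nopt ^ k)).
Proof.
move=> inv; have inM : input_at M by case: inv.
rewrite -(eval_pow r inM); apply: (post_for_unif (I := components_inv)) => // j M' C' _.
exact: post_components.
Qed.

End Phase1.

(** * Dynamic programming *)

Section Phase2.
Variables (k n m : nat) (G : sgraph 'I_n) (H : sgraph 'I_m) (psi : 'I_n -> 'I_m).
Variables (D : nat) (W : nat).
Hypotheses (le_mn : m <= n) (leW : n.+2 ^ D <= W).
Hypothesis G_H : forall u w, G u w -> psi u = psi w \/ H (psi u) (psi w).
Hypothesis G_clique : forall x, clique G (psi @^-1: [set x]).
Variable td : tree_decomposition H.
Hypothesis width_td : width td <= k.
Notation post := (post n.+2 D W).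
Notation nopt := (nopt n m).
Notation dig := (dig nopt).
Notation drop_dig := (drop_dig nopt).
Notation sep := (sep psi).
Notation outside := (outside H psi).
Notation proj := (proj psi).
Notation label := (label H psi).
Notation ext := (ext G H psi).
Notation avoid := (avoid m G).
Notation consistent := (consistent psi).
Notation compatible := (compatible m G).
Notation tame := (tame (n := n) psi td).
Notation cell := (cell n m).
Notation base := (base n m).
Notation count_cell := (count_cell m).
Notation input_at := (input_at G H psi).
Notation tables := (tables k H psi).
Notation class_size := (class_size m).
Notation post_for_unif := (post_for_unif (isT : 1 < n.+2) leW).
Notation post_ite_sum := (post_ite_sum (isT : 1 < n.+2) leW).
Notation post_ite := (post_ite (isT : 1 < n.+2) leW).
Notation post_store := (post_store (isT : 1 < n.+2) leW).
Notation post_seq := (post_seq (isT : 1 < n.+2) leW).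
Notation post_let := (post_let (isT : 1 < n.+2) leW).
Notation post_cset := (post_cset (isT : 1 < n.+2) leW).
Notation post_cplus := (post_cplus (isT : 1 < n.+2) leW).
Notation post_ctimes := (post_ctimes (isT : 1 < n.+2) leW).

Lemma class_sizeE l e (x : 'I_m) : x \notin sep l e ->
  class_size (label l e) x = #|[pred y | connect (outside l e) x y]|.
Proof.
move=> xS; rewrite -sum1_card big_mkcond; apply: eq_bigr => y _ /=.
by rewrite eq_sym label_eq // inE; case: (connect _ _ _).
Qed.

Lemma label_connect l e (x y : 'I_m) : connect (outside l e) x y -> label l e x = label l e
  y.
Proof.
have [xS|xS xy] := boolP (x \in sep l e); last by apply/eqP; rewrite label_eq.
move=> xy; have yS : y \in sep l e.
  by rewrite -[_ \in _]negbK -(connect_invariant (f := fun z =>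
    z \notin sep l e) _ xy) ?xS // => a b /and3P[_ -> ->].
by rewrite !label_sep.
Qed.

Lemma ext_connect l e (x y : 'I_m) : connect (outside l e) x y -> ext l e x = ext l e y.
Proof.
move=> xy; apply/setP => w; rewrite !in_ext.
by rewrite (same_connect (connect_outside_sym _ _ _ _) xy).
Qed.

Section Extension.
Variables (a g : nat) (v : 'I_m).
Hypotheses (a_lt : a < nopt ^ k) (vS : v \notin sep k a) (g_lt : g < nopt) (gv : proj g =
  v).
Notation e := (a + g * nopt ^ k).

Definition rest : pred 'I_m := [pred y | connect (outside k a) v y && (y != v)].

Lemma sep_ext y : (y \in sep k.+1 e) = (y \in sep k a) || (y == v).
Proof. by rewrite sep_cons // gv eq_sym. Qed.

Lemma rest_sep y : rest y -> y \notin sep k.+1 e.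
Proof.
by case/andP=> vy yv; rewrite sep_ext (negPf yv) orbF (connect_outside vS vy).
Qed.

Lemma rest_outside x y : outside k.+1 e x y -> rest x = rest y.
Proof.
case/and3P=> xy; rewrite !sep_ext !negb_or => /andP[xS xv] /andP[yS yv].
rewrite /rest /= xv yv !andbT; apply/idP/idP => c; apply: connect_trans c (connect1 _).
  by rewrite outsideE xy xS.
by rewrite outsideE adj_sym xy yS.
Qed.

Lemma outside_rest x y : rest x -> rest y -> H x y -> outside k.+1 e x y.
Proof. by move=> /rest_sep xS /rest_sep yS xy; rewrite outsideE xy xS. Qed.

Lemma rest_label y : rest y = (y != v) && (label k a y == label k a v).
Proof. by rewrite /rest /= andbC [label _ _ y == _]eq_sym label_eq. Qed.

(** By [connect_drop] the component of [y] is the same before and after the deletion; it lies in the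
    component of [v] and misses [v]. Hence factors come from earlier stages. *)
Lemma class_size_lt y i : rest y -> i <= k ->
  label k (drop_dig e i) y != label k (drop_dig e i) (proj (dig e i)) ->
  class_size (label k (drop_dig e i)) y < class_size (label k a) v.
Proof.
move=> ry ik neq; have yS := rest_sep ry.
rewrite !class_sizeE ?(sep_dropN ik yS) //; apply: proper_card; apply/properP; split.
  apply/subsetP => z; rewrite !inE -(connect_drop ik yS neq) => yz.
  suff /andP[] : rest z by [].
  by rewrite -(connect_invariant (f := rest) _ yz) // => b c; apply: rest_outside.
exists v; rewrite !inE ?connect0 // -(connect_drop ik yS neq).
apply/negP => yv; have := connect_outside yS yv.
by rewrite sep_ext eqxx orbT.
Qed.

End Extension.

Definition good (M : nat -> nat) (e : nat) (x : 'I_m) : bool := 0 < M (cell 3 e (label k e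
  x)).

Definition usable (M : nat -> nat) (e : nat) (y : 'I_m) (i : nat) : bool :=
  (label k (drop_dig e i) y != label k (drop_dig e i) (proj (dig e i)))
  && good M (drop_dig e i) y.

(** Consistency passes to the tuples from which a value is computed, so arbitrary values at
    inconsistent tuples do no harm. *)
Definition sound (M C : nat -> nat) : Prop :=
  forall e x, e < nopt ^ k -> x \notin sep k e -> consistent k e -> good M e x ->
    C (count_cell e (label k e x)) = count_in G (ext k e x).

Definition off_base (M M' : nat -> nat) : Prop := forall x, x != base -> M' x = M x.

Definition keep_counts (C C' : nat -> nat) : Prop := forall x, 3 <= x -> C' x = C x.

Lemma off_base_cell M M' f b x : off_base M M' -> 0 < f -> M' (cell f b x) = M (cell f b x).
Proof. by move=> off f0; apply: off; apply: cell_neq_base. Qed.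

Lemma input_off_base M M' : off_base M M' -> input_at M -> input_at M'.
Proof.
move=> off [In Im Ipsi IG IH]; have lt_base x : x < base -> M' x = M x.
  by move=> x_lt; apply: off; lia.
split=> [|||u w|x y].
- by rewrite lt_base // baseE; lia.
- by rewrite lt_base // baseE; lia.
- by move=> u; rewrite lt_base // baseE; have := ltn_ord u; lia.
- by rewrite lt_base // baseE; have := ltn_ord u; have := ltn_ord w; nia.
- by rewrite lt_base // baseE; have := ltn_ord x; have := ltn_ord y; nia.
Qed.

Lemma off_base_trans M1 M2 M3 : off_base M1 M2 -> off_base M2 M3 -> off_base M1 M3.
Proof. by move=> h1 h2 x xb; rewrite h2 ?h1. Qed.

Lemma off_base_mset M v : off_base M (mset M base v).
Proof. by move=> x xb; rewrite /mset /= ifN. Qed.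

Section Evaluation.
Variables (r M : nat -> nat).
Hypotheses (inM : input_at M) (tab : forall b, b < nopt ^ k -> tables b M).

Lemma table_label b x : b < nopt ^ k -> x <= m -> M (cell 1 b x) = label k b x.
Proof. by move=> bk xm; case: (tab bk) => ->. Qed.

Lemma eval_usable e (y : 'I_m) i : r 5 = e -> r 6 = y -> e < nopt ^ k.+1 -> i <= k ->
  0 < eval r M (eUsable i) = usable M e y i.
Proof.
move=> r5 r6 ek ik; have dk := drop_dig_lt (nopt_gt0 n m) ek ik.
have ym := ltnW (ltn_ord y).
rewrite /eUsable /= !(eval_label _ inM) (eval_cell _ inM) (eval_label _ inM).
rewrite !(eval_drop _ inM) (eval_proj_dig _ inM) /= r5 r6 !table_label ?proj_le //.
by rewrite /usable /good lt0b; case: eqP.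
Qed.

Lemma eval_findP e (y : 'I_m) : r 5 = e -> r 6 = y -> e < nopt ^ k.+1 ->
  [\/ (forall i, i <= k -> ~~ usable M e y i) /\ eval r M (eFind k) = 0
    | exists i, [/\ i <= k, usable M e y i & eval r M (eFind k) = (drop_dig e i).+1]].
Proof.
move=> r5 r6 ek; have [[no ->]|[i [ik ui ->]]] :=
  eval_anyP r M eUsable (fun i => add (eDrop (Var 5) i) (Cst 1)) (iota 0 k.+1).
  left; split=> // i ik; rewrite -(eval_usable r5 r6) // no //.
  by rewrite mem_iota.
have {}ik : i <= k by move: ik; rewrite mem_iota.
right; exists i; split=> //; first by rewrite -(eval_usable r5 r6).
by rewrite /= (eval_drop _ inM) /= r5 addn1.
Qed.

End Evaluation.

Definition option_cost (is_v : bool) : nat :=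
  ecost (Eqb (eProj (Var 4)) (Var 1)) + 2 + (if is_v then
    ecost (add (Var 0) (mul (Var 4) (ePow k))) + (scost (CSet (Cst 2) 1) +
      (ecost eM + 2 + m * (scost (p_factor k) + 3) +
        scost (Ite (eConflict k) Nop (CPlus (Cst 1) (Cst 1) (Cst 2))))) else 1).

Definition solve_cost (v : nat) : nat :=
  scost (Store eBase (Cst 0)) + (scost (CSet (Cst 1) 0) +
    (ecost eB + 2 + \sum_(g < nopt) (option_cost (proj g == v) + 3) + scost p_record)).

Definition invariant (M C : nat -> nat) : Prop :=
  [/\ input_at M, forall b, b < nopt ^ k -> tables b M & sound M C].

Definition complete (s : nat) (M : nat -> nat) : Prop := forall e x, e < nopt ^ k ->
  tame k e x -> class_size (label k e) x < s -> good M e x.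

(** All options above [v] are included, even incompatible ones: the factors are looked up before the
    conflict test, and a single missing factor makes the whole attempt fail. *)
Definition works (e : nat) (v : 'I_m) : Prop := forall y, rest e v y ->
  forall g, g < nopt -> proj g = v -> exists2 i, i <= k &
    let d := drop_dig (e + g * nopt ^ k) i in
    label k d y != label k d (proj (dig (e + g * nopt ^ k) i)) /\ tame k d y.

Definition done (s e : nat) (v : 'I_m) (M : nat -> nat) : Prop :=
  v \notin sep k e -> class_size (label k e) v = s -> works e v -> good M e v.

Definition mono (M M' : nat -> nat) : Prop :=
  forall e (x : 'I_m), good M e x -> good M' e x.

Lemma complete_mono s M M' : mono M M' -> complete s M -> complete s M'.
Proof. by move=> mm cM e x ek tx lt_s; apply: mm; apply: cM. Qed.

Lemma done_mono s e v M M' : mono M M' -> done s e v M -> done s e v M'.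
Proof. by move=> mm dM vS sz wv; apply: mm; apply: dM. Qed.

Section Try.
Variables (s a : nat) (v : 'I_m) (r M0 C0 : nat -> nat).
Hypotheses (r0 : r 0 = a) (r1 : r 1 = v) (r3 : r 3 = s) (a_lt : a < nopt ^ k).
Hypotheses (inM0 : input_at M0) (tab0 : forall b, b < nopt ^ k -> tables b M0).
Hypothesis sound0 : sound M0 C0.

Definition factors_usable (g : nat) : Prop := forall y : 'I_m, rest a v y ->
  exists2 i, i <= k & usable M0 (a + g * nopt ^ k) y i.

Section Solve.
Hypothesis vS : v \notin sep k a.

Lemma off_tables M : off_base M0 M -> forall b, b < nopt ^ k -> tables b M.
Proof.
by move=> off b bk; have [t1 t2] := tab0 bk; split=> x xm;
  rewrite (off_base_cell _ _ off) // ?t1 ?t2.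
Qed.

Lemma off_usable M e y i : off_base M0 M -> usable M e y i = usable M0 e y i.
Proof. by move=> off; rewrite /usable /good (off_base_cell _ _ off). Qed.

Section Factor.
Variables (g : nat).
Hypotheses (g_lt : g < nopt) (gv : proj g = v).
Notation e := (a + g * nopt ^ k).
Notation below := (rep_below psi (outside k.+1 e) (rest a v) (avoid k.+1 e)).

(** While the flag word is unset, counter 2 is the product so far; the last clause says that the
    flag is set only for lack of a usable tuple. *)
Definition factor_inv (M C : nat -> nat) (y : nat) (M' C' : nat -> nat) : Prop :=
  [/\ off_base M0 M', keep_counts C0 C' /\ C' 1 = C 1,
     M' base = 0 -> M base = 0 /\ (consistent k a -> C' 2 = count_in G (below y))
   & M base = 0 -> factors_usable g -> M' base = 0].

Lemma post_factor r' M C y M' C' : r' 0 = a -> r' 1 = v -> r' 5 = e -> r' 6 = y ->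
  y < m -> factor_inv M C y M' C' ->
  post (p_factor k) r' M' C' (scost (p_factor k)) (factor_inv M C y.+1).
Proof.
move=> r'0 r'1 r'5 r'6 y_lt [off [keep C1] zero usab].
have inM' := input_off_base off inM0; have tab' := off_tables off.
pose yo := Ordinal y_lt.
have ek : e < nopt ^ k.+1 by apply: cons_dig_lt.
have step : count_in G (below y.+1) = count_in G (below y) *
    (if rest a v yo && (rep (outside k.+1 e) yo == y) then count_in G (ext k.+1 e yo) else
      1).
  apply: (@count_rep_step _ _ _ H _ G_H _ _ _ _ _ _ yo).
  - exact: outside_sym.
  - by move=> x z; apply: rest_outside.
  - by move=> x z; apply: outside_rest.
have cnd : (0 < eval r' M' (Cond (Eqb (Var 6) (Var 1)) (Cst 0)
         (Eqb (eLabel (Var 0) (Var 6)) (eLabel (Var 0) (Var 1))))) = rest a v yo.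
  rewrite /= !(eval_label _ inM') /= r'0 r'1 r'6 rest_label // !(table_label tab') ?(ltnW
    (ltn_ord v)) ?(ltnW y_lt) //.
  by rewrite lt0b -val_eqE /=; case: (y == v); rewrite //= lt0b.
apply: post_ite_sum => [|/eqP]; last first.
  rewrite -leqn0 leqNgt cnd => /negPf ry; apply: post_nop; split=> // z'.
  by have [-> cs] := zero z'; split=> // ca; rewrite step ry muln1 cs.
rewrite cnd => ry; apply: post_let; set r7 := upd r' 7 _.
have [r76 r77] : r7 6 = y /\ r7 7 = eval r' M' (eFind k) by rewrite -r'6.
have yS : yo \notin sep k.+1 e by apply: rest_sep ry.
case: (eval_findP (r := r') (y := yo) inM' tab' r'5 r'6 ek) =>
  [[no find0]|[i [ik ui findE]]].
  apply: post_ite_sum; rewrite /= r77 find0 // => _.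
  apply: post_store => //=; rewrite (eval_base _ inM'); split=> //.
  - exact: off_base_trans off (off_base_mset _ _).
  - by rewrite /mset /= eqxx.
  - move=> _ /(_ yo ry)[i ik ui]; case/negP: (no i ik).
    by rewrite (off_usable _ _ _ off).
apply: post_ite_sum; rewrite /= r77 findE // => _.
set d := drop_dig e i in findE *.
have dk : d < nopt ^ k by apply: drop_dig_lt.
have r7E : eval r7 M' (sub (Var 7) (Cst 1)) = d by rewrite /= r77 findE subn1.
have /andP[neq gd] := ui.
(* The deletion keeps the component, so the stored label is the representative that [rep_below]
   refers to. *)
have lab_d : label k d yo = rep (outside k.+1 e) yo.
  by rewrite (label_drop ik yS neq) labelE.
have cnd2 : eval r7 M' (Eqb (eLabel (sub (Var 7) (Cst 1)) (Var 6)) (Var 6)) =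
    (rep (outside k.+1 e) yo == y).
  by rewrite /= (eval_label _ inM') r7E /= r76 (table_label tab') ?(ltnW y_lt) // -[y in
    label _ _ y]/(val yo) lab_d.
apply: post_ite_sum; rewrite cnd2 => Dy.
  have {}Dy : rep (outside k.+1 e) yo = y by move: Dy; rewrite lt0b => /eqP.
  apply: post_ctimes; rewrite /= (eval_count _ inM') r7E /= r76; split=> //.
  - by split=> [x x3|]; rewrite /mset /= ?C1 // ifN ?keep //; lia.
  - move=> z'; have [-> cs] := zero z'; split=> // ca;
    rewrite /mset /= cs // step ry Dy eqxx /=.
    congr (_ * _).
    have ce : consistent k.+1 e by apply: consistent_cons vS.
    rewrite keep; last exact: count_cell_ge3.
    rewrite -(ext_drop ik yS neq G_H ce) -sound0 //.
    + by rewrite lab_d Dy.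
    + exact: sep_dropN yS.
    + exact: consistent_drop ce.
    + by move: gd; rewrite /good (off_base_cell _ _ off).
apply: post_nop; split=> // z'; have [-> cs] := zero z'; split=> // ca.
by rewrite step; case: eqP Dy => // _ _; rewrite andbF muln1 cs.
Qed.

End Factor.
Definition factor_term (g : nat) : nat :=
  count_in G [set w | rest a v (psi w) & w \in avoid k.+1 (a + g * nopt ^ k)].

Definition solve_inv (g : nat) (M C : nat -> nat) : Prop :=
  [/\ off_base M0 M, keep_counts C0 C,
     M base = 0 -> consistent k a -> C 1 =
       \sum_(0 <= g' < g | (proj g' == v) && compatible k a g') factor_term g'
   & (forall g', g' < nopt -> proj g' = v -> factors_usable g') -> M base = 0].

Lemma post_option g M C : g < nopt -> solve_inv g M C ->
  post (p_option k) (upd r 4 g) M C (option_cost (proj g == v)) (solve_inv g.+1).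
Proof.
move=> g_lt [off keep val_v flag]; have inM := input_off_base off inM0.
set r4 := upd r 4 g; have [r40 r41 r44] : [/\ r4 0 = a, r4 1 = v & r4 4 = g] by [].
have cnd : (0 < eval r4 M (Eqb (eProj (Var 4)) (Var 1))) = (proj g == v).
  by rewrite /= (eval_proj inM) //= r44 r41 lt0b.
rewrite /option_cost -cnd; apply: post_ite; last first.
  move/eqP; rewrite -leqn0 leqNgt cnd => gv; apply: post_nop; split=> // z' ca.
  by rewrite big_mkcond big_nat_recr //= -big_mkcond (negPf gv) /= addn0 val_v.
rewrite cnd => /eqP gv; apply: post_let; set r5 := upd r4 5 _.
have r55 : r5 = upd r4 5 (a + g * nopt ^ k).
  by rewrite /r5 /= (eval_pow _ inM) r40 r44.
have [r54 r50] : r5 4 = g /\ r5 0 = a by [].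
pose C1 := mset C 2 1.
apply: (post_seq (R := fun M' C' => M' = M /\ C' = C1)); first by apply: post_cset.
move=> _ _ [-> ->].
have keep1 : keep_counts C0 C1 by move=> x x3; rewrite /C1 /mset /= ifN ?keep //; lia.
have eM_m := eval_M r5 inM.
apply: (post_seq (R := factor_inv g M C1 m)).
  rewrite -{1}eM_m; apply: (post_for_unif (I := factor_inv g M C1)) => [|y M' C'|M' C'].
  - by split=> // z'; split=> // _; rewrite rep_below0.
  - by rewrite eM_m r55 => y_lt inv; exact: post_factor.
  - by rewrite eM_m.
move=> M2 C2 [off2 [keep2 C21] zero2 usab2]; have inM2 := input_off_base off2 inM0.
have C2_1 : C2 1 = C 1 by rewrite C21.
have flag2 : (forall g', g' < nopt -> proj g' = v -> factors_usable g') -> M2 base = 0.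
  by move=> us; apply: usab2 (flag us) (us g g_lt gv).
have conf : eval r5 M2 (eConflict k) = ~~ compatible k a g.
  by rewrite (eval_conflict k inM2) r54 ?r50.
have sumE : \sum_(0 <= g' < g.+1 | (proj g' == v) && compatible k a g') factor_term g' =
    \sum_(0 <= g' < g | (proj g' == v) && compatible k a g') factor_term g' +
    (if compatible k a g then factor_term g else 0).
  by rewrite big_mkcond big_nat_recr //= -big_mkcond gv eqxx.
have C2_2 : M2 base = 0 -> consistent k a -> C2 2 = factor_term g.
  move=> z' ca; have [_ ->//] := zero2 z'; congr count_in; exact: rep_below_all.
apply: post_ite_sum; rewrite conf => Dc.
  apply: post_nop; split=> // z' ca; rewrite sumE; have [z0 _] := zero2 z'.
  by move: Dc; rewrite lt0b => /negPf->; rewrite addn0 C2_1 val_v.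
have {}Dc : compatible k a g by move: Dc; case: (compatible _ _ _).
apply: post_cplus; split=> //.
- by move=> x x3; rewrite /mset /= ifN ?keep2 //; lia.
- move=> z' ca; rewrite sumE Dc /mset /= C2_1 C2_2 // val_v //.
  by case: (zero2 z').
Qed.

Lemma post_solve :
  post (Sq (Store eBase (Cst 0)) (Sq (CSet (Cst 1) 0) (Sq (For 4 eB (p_option k))
    p_record)))
    r M0 C0 (solve_cost v) (fun M C =>
  [/\ input_at M /\ (forall b, b < nopt ^ k -> tables b M), sound M C, mono M0 M
    & (forall g, g < nopt -> proj g = v -> factors_usable g) -> good M a v]).
Proof.
have eval_base0 := eval_base r inM0.
apply: (post_seq (R := fun M C => M = mset M0 base 0 /\ C = C0)).
  by apply: post_store; rewrite /= ?eval_base0.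
move=> _ _ [-> ->]; set M1 := mset M0 base 0.
apply: (post_seq (R := fun M C => M = M1 /\ C = mset C0 1 0)); first by apply: post_cset.
move=> _ _ [-> ->].
have off1 : off_base M0 M1 by apply: off_base_mset.
have inM1 := input_off_base off1 inM0.
have eB1 := eval_B r inM1.
apply: (post_seq (R := solve_inv nopt)).
  have := @post_for _ _ _ (isT : 1 < n.+2) leW 4 eB (p_option k) r M1 (mset C0 1 0)
    solve_inv (fun g => option_cost (proj g == v)) (solve_inv nopt).
  rewrite eB1; apply=> // [|g M C]; last exact: post_option.
  split=> //.
  - by move=> x x3; rewrite /mset /= ifN //; lia.
  - by move=> _ _; rewrite big_geq.
  - by rewrite /M1 /mset /= eqxx.
move=> M C [off keep val_v flag]; have inM := input_off_base off inM0.
have same b x : good M b x = good M0 b x by rewrite /good (off_base_cell _ _ off).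
have tab := off_tables off.
have lab : eval r M (eLabel (Var 0) (Var 1)) = label k a v.
  by rewrite (eval_label _ inM) /= r0 r1 (table_label tab) // ltnW.
have lm : label k a v <= m by apply: label_le.
apply: post_ite_sum; rewrite /= (eval_base _ inM) => Mb.
  apply: post_nop; split=> //.
  - move=> e x ek xS ce; rewrite same => gx; rewrite keep; last exact: count_cell_ge3.
    exact: sound0.
  - by move=> e x; rewrite same.
  - by move=> us; rewrite flag in Mb.
pose M2 := mset M (cell 3 a (label k a v)) 1.
apply: (post_seq (R := fun M' C' => M' = M2 /\ C' = C)).
  by apply: post_store; rewrite // (eval_cell _ inM) lab /= r0.
move=> _ _ [-> ->].
have inM2 : input_at M2 by apply: input_mset (base_cell _ _ _ _ _) inM.
have tab2 b : b < nopt ^ k -> tables b M2.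
  by move=> bk; have [t1 t2] := tab b bk; split=> x xm;
    rewrite /M2 mset_cell ?(ltnW xm) //= ?t1 ?t2.
have lab2 : eval r M2 (eLabel (Var 0) (Var 1)) = label k a v.
  by rewrite (eval_label _ inM2) /= r0 r1 (table_label tab2) // ltnW.
have cntE : eval r M2 (eCount (Var 0) (eLabel (Var 0) (Var 1))) = count_cell a (label k a
  v).
  by rewrite (eval_count _ inM2) lab2 /= r0.
apply: (post_seq (R := fun M' C' => M' = M2 /\ C' = mset C (count_cell a (label k a v)) 0)).
  by apply: post_cset; rewrite cntE.
move=> _ _ [-> ->]; apply: post_cplus; rewrite !cntE /=.
have goodE b x : good M2 b x = good M b x || (b == a) && (label k b x == label k a v).
  rewrite /good /M2 mset_cell ?label_le //=.
  by case: ((b == a) && _); rewrite ?orbT ?orbF.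
split=> //.
- move=> e x ek xS ce; rewrite goodE mset_count ?label_le //; case: ifP =>
  [/andP[/eqP Da lx] _|ne].
    (* The entry is stored under a label and answers for all vertices [x] of the component of [v],
       whose sets [ext] coincide. *)
    have vx : connect (outside k a) v x by move: lx; rewrite Da eq_sym label_eq.
    rewrite /mset /= eqxx add0n.
    rewrite Da -(ext_connect vx) (count_ext_split H G_clique a_lt vS) val_v //;
      last by rewrite -Da.
    by rewrite big_mkord.
  rewrite orbF same => gx; rewrite mset_count ?label_le // ne keep;
    last exact: count_cell_ge3.
  exact: sound0.
- by move=> b x; rewrite goodE same => ->.
- by move=> _; rewrite goodE !eqxx orbT.
Qed.

End Solve.
Definition try_cost (s e v : nat) : nat :=
  ecost (Cond (Ltb (eLabel (Var 0) (Var 1)) eM)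
     (Eqb (Mem (eCell 2 (Var 0) (Var 1))) (Var 3)) (Cst 0)) + 2 +
  (if (label k e v < m) && (class_size (label k e) v == s) then solve_cost v else 1).

Lemma post_try : complete s M0 -> post (p_try k) r M0 C0 (try_cost s a v)
  (fun M C => [/\ invariant M C, mono M0 M & done s a v M]).
Proof.
move=> cM; have vm := ltn_ord v; have [t1 t2] := tab0 a_lt.
have cnd : (0 < eval r M0 (Cond (Ltb (eLabel (Var 0) (Var 1)) eM)
     (Eqb (Mem (eCell 2 (Var 0) (Var 1))) (Var 3)) (Cst 0))) =
     (label k a v < m) && (class_size (label k a) v == s).
  rewrite /= (eval_label _ inM0) (eval_cell _ inM0) (eval_M _ inM0) /= r0 r1 r3 lt0b.
  by rewrite t1 ?(ltnW vm) // t2 //; case: (label k a v < m); rewrite //= lt0b.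
rewrite /try_cost -cnd; apply: post_ite; last first.
  move/eqP; rewrite -leqn0 leqNgt cnd label_lt => no; apply: post_nop; split=> //.
  by move=> vS sz; rewrite vS sz eqxx in no.
rewrite cnd label_lt => /andP[vS /eqP sz].
apply: post_weaken (post_solve vS) => // M C [[inM tab] sM mM usM]; split=> // _ _ wv.
apply: usM => g gB gv y ry; have [i ik [neq ty]] := wv y ry g gB gv.
exists i; rewrite // /usable neq; apply: cM ty _.
  by apply: drop_dig_lt => //; apply: cons_dig_lt.
by rewrite -sz; apply: class_size_lt.
Qed.

End Try.

Definition stage_cost (s : nat) : nat := ecost (ePow k) + 2 +
  \sum_(e < nopt ^ k) (ecost eM + 2 + \sum_(v < m) (try_cost s e v + 3) + 3).

Lemma post_stage r s M C : r 3 = s -> invariant M C -> complete s M ->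
  post (For 0 (ePow k) (For 1 eM (p_try k))) r M C (stage_cost s)
    (fun M' C' => invariant M' C' /\ complete s.+1 M').
Proof.
move=> r3 inv cM.
pose I e M' (C' : nat -> nat) := [/\ invariant M' C', complete s M'
  & forall e' v, e' < e -> done s e' v M'].
have inM : input_at M by case: inv.
have := @post_for _ _ _ (isT : 1 < n.+2) leW 0 (ePow k) (For 1 eM (p_try k)) r M C I
  (fun e => ecost eM + 2 + \sum_(v < m) (try_cost s e v + 3)).
rewrite (eval_pow _ inM); apply=> [|e M1 C1 ek [inv1 cM1 dM1]|M1 C1 [inv1 cM1 dM1]].
- by split.
- pose J v M' (C' : nat -> nat) := [/\ invariant M' C', complete s M',
    forall e' v, e' < e -> done s e' v M' & forall v' : 'I_m, v' < v -> done s e v' M'].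
  have inM1 : input_at M1 by case: inv1.
  have := @post_for _ _ _ (isT : 1 < n.+2) leW 1 eM (p_try k) (upd r 0 e) M1 C1 J
    (fun v => try_cost s e v) (I e.+1).
  rewrite (eval_M _ inM1); apply=> [|v M2 C2 v_lt [inv2 cM2 dM2 dM2']|M2 C2 [inv2 cM2 dM2
    dM2']].
  + by split.
  + have [inM2 tab2 sM2] := inv2.
    have := @post_try s e (Ordinal v_lt) (upd (upd r 0 e) 1 v) M2 C2 erefl erefl r3 ek inM2
      tab2 sM2 cM2.
    apply: post_weaken => // M3 C3 [inv3 mM3 dM3]; split=> //.
    * exact: complete_mono cM2.
    * by move=> e' v' e'e; apply: done_mono mM3 _; apply: dM2.
    * move=> v'; rewrite ltnS leq_eqVlt => /orP[/eqP Dv|v'v];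
      last by apply: done_mono mM3 _; apply: dM2'.
      by have -> : v' = Ordinal v_lt by apply: val_inj.
  + split=> // e' v; rewrite ltnS leq_eqVlt => /orP[/eqP->|]; last exact: dM2.
    exact: dM2'.
- split=> // e x ek tx; rewrite ltnS leq_eqVlt => /orP[/eqP sz|]; last exact: cM1.
  have xS : x \notin sep k e by case: tx.
  (* Every vertex of the component has been tried in this stage; [tame_step] names one for which the
     attempt succeeds, and the entry it solves is also that of [x]. *)
  have [v xv wv] := tame_step width_td ek tx.
  have lxv := label_connect xv.
  have : good M1 e v.
    apply: dM1 => //; first exact: connect_outside xv.
      by rewrite -sz; apply: eq_bigr => y _; rewrite lxv.
    move=> y /andP[vy yv] g gB gv; apply: wv => //; exact: connect_trans xv vy.
  by rewrite /good lxv.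
Qed.

Definition search_cost : nat :=
  ecost eM1 + 2 + \sum_(s < m.+1) (stage_cost s + 3).

Lemma post_search r M C : invariant M C ->
  post (For 3 eM1 (For 0 (ePow k) (For 1 eM (p_try k)))) r M C search_cost
    (fun M' C' => invariant M' C' /\ complete m.+1 M').
Proof.
move=> inv; have inM : input_at M by case: inv.
have := @post_for _ _ _ (isT : 1 < n.+2) leW 3 eM1 (For 0 (ePow k) (For 1 eM (p_try k))) r
  M C
  (fun s M' C' => invariant M' C' /\ complete s M') stage_cost.
rewrite (eval_M1 _ inM); apply=> // s M1 C1 _ [inv1 cM1].
exact: post_stage.
Qed.

End Phase2.

(** * The entry with empty separator and the whole program *)

Section Null.
Variables (k n m : nat) (G : sgraph 'I_n) (H : sgraph 'I_m) (psi : 'I_n -> 'I_m).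
Notation nopt := (nopt n m).

(* The tuple of dummies, whose separator is empty. *)
Definition null_index (l : nat) : nat := iter l (fun e => e * nopt + m) 0.

Lemma m_lt_nopt : m < nopt. Proof. by rewrite ltnS leq_addl. Qed.

Lemma null_index_lt l : null_index l < nopt ^ l.
Proof.
elim: l => //= l IH; rewrite expnSr; apply: (@leq_trans ((null_index l).+1 * nopt)).
  by rewrite mulSn addnC ltn_add2r m_lt_nopt.
by rewrite leq_mul2r IH orbT.
Qed.

Lemma dig_null l j : j < l -> dig nopt (null_index l) j = m.
Proof.
elim: l j => //= l IH [|j] jl.
  by rewrite /dig divn1 modnMDl modn_small // m_lt_nopt.
rewrite /dig expnS divnMA divnMDl // [m %/ _]divn_small ?m_lt_nopt // addn0; exact: IH.
Qed.

Lemma eval_null r M : input_at G H psi M -> eval r M (eNull k) = null_index k.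
Proof.
move=> inM; rewrite /eNull; elim: (k) => //= l ->.
by rewrite (eval_B _ inM) (eval_M _ inM).
Qed.

Lemma sep_null : sep psi k (null_index k) = set0.
Proof.
apply/setP => x; rewrite in_set0; apply/negP => /sepP[j jk]; rewrite dig_null //.
by rewrite proj_small // => Dx; have := ltn_ord x; rewrite -Dx ltnn.
Qed.

Lemma avoid_null : avoid m G k (null_index k) = setT.
Proof.
apply/setP => w; rewrite in_setT; apply/avoidP => u /chosenP[j jk].
by rewrite dig_null //; lia.
Qed.

Lemma consistent_null : consistent psi k (null_index k).
Proof. by move=> i j ik jk _; rewrite !dig_null. Qed.

Lemma tame_null (td : tree_decomposition H) x : tame (n := n) psi td k (null_index k) x.
Proof.
have xS : x \notin sep psi k (null_index k) by rewrite sep_null in_set0.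
split=> //; have [/card_gt0P[t _] _ _] := tree_is_tree td; exists t.
by apply: subset_trans (nbh_component _ xS) _; rewrite sep_null sub0set.
Qed.

End Null.

Section Program.
Variables (k n m : nat) (G : sgraph 'I_n) (H : sgraph 'I_m) (psi : 'I_n -> 'I_m).
Variables (D : nat) (W : nat).
Hypotheses (le_mn : m <= n) (leW : n.+2 ^ D <= W).
Hypothesis G_H : forall u w, G u w -> psi u = psi w \/ H (psi u) (psi w).
Hypothesis G_clique : forall x, clique G (psi @^-1: [set x]).
Variable td : tree_decomposition H.
Hypothesis width_td : width td <= k.
Notation post := (post n.+2 D W).
Notation nopt := (nopt n m).
Notation null := (null_index n m k).

Definition final_cost : nat := ecost (eNull k) +
  (scost (CSet (Cst 0) 1) + (ecost eM + 2 + m * (scost p_final + 3))).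

Lemma post_final r M C : invariant k G H psi M C -> complete k psi td m.+1 M ->
  post (Let 0 (eNull k) (Sq (CSet (Cst 0) 1) (For 6 eM p_final))) r M C final_cost
    (fun _ C' => C' 0 = count_independent_sets G).
Proof.
move=> [inM tab sM] cM; apply: (post_let (isT : 1 < n.+2) leW).
rewrite (eval_null _ _ inM); set r' := upd r 0 _.
apply: (post_seq (isT : 1 < n.+2) leW (R := fun M' C' => M' = M /\ C' = mset C 0 1)).
  exact: (post_cset (isT : 1 < n.+2) leW).
move=> _ _ [-> ->].
pose below := rep_below psi (outside H psi k null) predT (avoid m G k null).
pose I y (M' C' : nat -> nat) := [/\ M' = M,
  keep_counts C C' & C' 0 = count_in G (below y)].
have := @post_for_unif _ _ _ (isT : 1 < n.+2) leW 6 eM p_final r' M (mset C 0 1) I.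
rewrite (eval_M _ inM); apply=> [|y _ C' y_lt [-> keep C'0]|M' C' [_ _ ->]]; last first.
- rewrite /below rep_below_all avoid_null -count_in_setT; congr count_in.
  by apply/setP => w; rewrite !inE.
- have r'0 : r' 0 = null by [].
  pose yo := Ordinal y_lt; have yS : yo \notin sep psi k null by rewrite sep_null in_set0.
  have null_lt : null < nopt ^ k by apply: null_index_lt.
  have lab : label H psi k null y = rep (outside H psi k null) yo by rewrite -[y]/(val yo)
    labelE.
  have cnd : eval (upd r' 6 y) M (Eqb (eLabel (Var 0) (Var 6)) (Var 6)) =
      (rep (outside H psi k null) yo == y).
    by rewrite /= (eval_label _ inM) /= r'0 (table_label tab) // ?lab // ltnW.
  have step : count_in G (below y.+1) = count_in G (below y) *
      (if rep (outside H psi k null) yo == y then count_in G (ext G H psi k null yo) else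
        1).
    apply: (@count_rep_step _ _ _ H _ G_H _ predT _ _ _ _ yo) => //.
    + exact: outside_sym.
    + by move=> x z _ _ xz; rewrite /outside /= xz sep_null !in_set0.
  apply: (post_ite_sum (isT : 1 < n.+2) leW); rewrite cnd => Dy.
    have {}Dy : rep (outside H psi k null) yo = y by move: Dy; rewrite lt0b => /eqP.
    apply: (post_ctimes (isT : 1 < n.+2) leW); rewrite (eval_count _ inM) /= r'0;
      split=> //.
    + by move=> x x3; rewrite /mset /= ifN ?keep //; lia.
    + rewrite /mset /= C'0 step Dy eqxx keep //; congr (_ * _).
      rewrite -[y in LHS]Dy -lab -[y]/(val yo) sM //; first exact: consistent_null.
      apply: cM => //; first exact: tame_null.
      by rewrite ltnS (class_sizeE _ yS) -[leqRHS]card_ord max_card.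
  apply: post_nop; split=> //; rewrite step; move: Dy; case: eqP => // _ _.
  by rewrite muln1.
- split=> //; first by move=> x x3; rewrite /mset /= ifN //; lia.
  by rewrite rep_below0.
Qed.

Definition phase1_cost : nat := ecost (ePow k) + 2 + nopt ^ k * (components_cost k m + 3).

Lemma components_inv_init (M C : nat -> nat) :
  M = nth 0 (encode G H psi) -> components_inv k G H psi 0 M C.
Proof.
have zero f b x : nth 0 (encode G H psi) (cell n m f b x) = 0.
  by rewrite nth_default // encode_size base_cell.
by move=> ->; split=> //; exact: encode_input.
Qed.

Lemma post_program r C : post (program k) r (nth 0 (encode G H psi)) C
  (phase1_cost + (search_cost k H psi + final_cost))
  (fun _ C' => C' 0 = count_independent_sets G).
Proof.
apply: (post_seq (isT : 1 < n.+2) leW (R := components_inv k G H psi (nopt ^ k))).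
  by apply: post_phase1 => //; apply: components_inv_init.
move=> M1 C1 [inM1 good1 _ tab1].
have inv1 : invariant k G H psi M1 C1.
  (* No entry is solved yet, so soundness holds vacuously. *)
  by split=> // e x ek xS _; rewrite /good good1 // label_le.
apply: (post_seq (isT : 1 < n.+2) leW
  (R := fun M' C' => invariant k G H psi M' C' /\ complete k psi td m.+1 M')).
  exact: post_search.
by move=> M2 C2 [inv2 cM2]; apply: post_final.
Qed.

End Program.

(** * Running time *)

Lemma leq_addM x1 x2 y1 y2 z : x1 <= y1 * z -> x2 <= y2 * z -> x1 + x2 <= (y1 + y2) * z.
Proof. by move=> h1 h2; rewrite mulnDl leq_add. Qed.

Lemma leq_constM c z : 0 < z -> c <= c * z.
Proof. by move=> z0; rewrite leq_pmulr. Qed.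

Lemma leq_mulSM m x y j : x <= y * m.+1 ^ j -> m * x <= y * m.+1 ^ j.+1.
Proof. by move=> h; rewrite expnS mulnCA; apply: leq_mul. Qed.

Lemma components_cost_le k : exists K, forall m, components_cost k m <= K * m.+1 ^ 2.
Proof.
rewrite /components_cost /insert_cost; eexists => m.
have pos j : 0 < m.+1 ^ j by rewrite expn_gt0.
(* The constant is an existential variable, assembled by unification along the shape of the cost. *)
by repeat first [apply: leq_mulSM | apply: leq_addM | apply: leq_constM].
Qed.

Section SearchCost.
Variables (k n m : nat) (H : sgraph 'I_m) (psi : 'I_n -> 'I_m).
Hypothesis le_mn : m <= n.
Notation nopt := (nopt n m).
Notation A := n.+1.

Definition option_const : nat := ecost (Eqb (eProj (Var 4)) (Var 1)) + 2 + 1.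

Definition option_slope : nat :=
  ecost (add (Var 0) (mul (Var 4) (ePow k))) + (scost (CSet (Cst 2) 1) +
  (ecost eM + 2 + (scost (p_factor k) + 3) +
   scost (Ite (eConflict k) Nop (CPlus (Cst 1) (Cst 1) (Cst 2))))).

Lemma option_cost_le (b : bool) : option_cost k m b <= option_const + b * (option_slope *
  A).
Proof.
rewrite /option_cost /option_const /option_slope.
case: b; rewrite ?mul1n ?mul0n ?addn0 //.
move: (ecost _) (ecost _) (scost _) (ecost _) (scost _) (scost _) => c0 c1 c2 c3 c4 c5.
have : m * (c4 + 3) <= (c4 + 3) * A by rewrite mulnC leq_mul2l leqW ?orbT.
move: (c4 + 3) => c; nia.
Qed.

Definition solve_const : nat := scost (Store eBase (Cst 0)) + (scost (CSet (Cst 1) 0) +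
  (ecost eB + 2 + scost p_record)).

(* Each option lies above one vertex only, so that the inner loops are run for
   [nopt] pairs of a vertex and an option rather than [m * nopt]. *)
Lemma sum_solve_cost : \sum_(v < m) solve_cost k psi v <=
  (solve_const + 2 * (option_const + 3) + 2 * option_slope) * A ^ 2.
Proof.
have le_solve (v : 'I_m) : solve_cost k psi v <= solve_const + nopt * (option_const + 3) +
    \sum_(g < nopt) (proj psi g == v) * (option_slope * A).
  rewrite /solve_cost /solve_const.
  have : \sum_(g < nopt) (option_cost k m (proj psi g == v) + 3) <=
      nopt * (option_const + 3) + \sum_(g < nopt) (proj psi g == v) * (option_slope * A).
    rewrite -[X in X * (option_const + 3)]card_ord -sum_nat_const -big_split /=.
    by apply: leq_sum => g _; rewrite addnAC leq_add2r option_cost_le.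
  move: (\sum_(g < nopt) (option_cost _ _ _ + _)) => S1; lia.
apply: (@leq_trans (\sum_(v < m) (solve_const + nopt * (option_const + 3) +
    \sum_(g < nopt) (proj psi g == v) * (option_slope * A)))).
  by apply: leq_sum => v _; apply: le_solve.
rewrite big_split sum_nat_const card_ord exchange_big /=.
have le_slope : \sum_(g < nopt) \sum_(v < m) (proj psi g == v) * (option_slope * A) <=
    nopt * (option_slope * A).
  rewrite -[X in X * (option_slope * A)]card_ord -sum_nat_const; apply: leq_sum => g _.
  rewrite -big_distrl /= -[leqRHS]mul1n leq_mul2r; apply/orP; right.
  have [lt_m|ge_m] := ltnP (proj psi g) m.
    rewrite (bigD1 (Ordinal lt_m)) //= eqxx big1 // => v; rewrite -val_eqE /= eq_sym.
    by move=> /negPf->.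
  by rewrite big1 // => v _; rewrite gtn_eqF // (leq_trans (ltn_ord v)).
have nopt_le : nopt <= 2 * A by rewrite noptE; lia.
apply: leq_trans (leq_add (leqnn _) le_slope) _.
move: solve_const (option_const + 3) option_slope nopt nopt_le => c1 c2 c3 N NA.
have mA : m <= A by apply: leqW.
have h1 : m * (c1 + N * c2) <= A * (c1 + 2 * A * c2).
  by apply: leq_mul => //; rewrite leq_add2l leq_mul2r NA orbT.
have h2 : N * (c3 * A) <= 2 * A * (c3 * A) by rewrite leq_mul2r NA orbT.
apply: leq_trans (leq_add h1 h2) _; nia.
Qed.

(** Each 5 is the overhead 2 of a loop plus the 3 per turn of the loop around it; the 6 is 2 for
    branching, 1 for the empty branch and 3 for the turn. *)
Definition search_const : nat := ecost eM1 + 2 + (ecost (ePow k) + 5 + (ecost eM + 5 +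
  (ecost (Cond (Ltb (eLabel (Var 0) (Var 1)) eM)
     (Eqb (Mem (eCell 2 (Var 0) (Var 1))) (Var 3)) (Cst 0)) + 6 +
  (solve_const + 2 * (option_const + 3) + 2 * option_slope)))).

(* A pair [(e, v)] is solved in one stage only, that of the size of its component. *)
Lemma search_cost_le : search_cost k H psi <= search_const * (nopt ^ k * A ^ 2).
Proof.
have N_gt0 : 0 < nopt ^ k by rewrite expn_gt0.
set N := nopt ^ k in N_gt0 *.
set ct := ecost (Cond (Ltb (eLabel (Var 0) (Var 1)) eM)
     (Eqb (Mem (eCell 2 (Var 0) (Var 1))) (Var 3)) (Cst 0)) + 6.
set cs := solve_const + 2 * (option_const + 3) + 2 * option_slope.
have le_try s e (v : 'I_m) : try_cost k H psi s e v + 3 <=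
    ct + (class_size m (label H psi k e) v == s) * solve_cost k psi v.
  by rewrite /try_cost /ct; case: ifP => [/andP[_ ->]|_]; lia.
have sum_try : \sum_(s < m.+1) \sum_(e < N) \sum_(v < m) (try_cost k H psi s e v + 3) <=
    m.+1 * (N * (m * ct)) + N * (cs * A ^ 2).
  have bound1 : \sum_(s < m.+1) \sum_(e < N) \sum_(v < m) (try_cost k H psi s e v + 3) <=
    \sum_(s < m.+1) \sum_(e < N) \sum_(v < m)
      (ct + (class_size m (label H psi k e) v == s) * solve_cost k psi v).
    by do 3!apply: leq_sum => ? _.
  apply: leq_trans bound1 _.
  under eq_bigr => s _ do under eq_bigr =>
    e _ do rewrite big_split /= sum_nat_const card_ord.
  under eq_bigr => s _ do rewrite big_split /= sum_nat_const card_ord.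
  rewrite big_split /= sum_nat_const card_ord leq_add2l.
  rewrite exchange_big /= -[X in X * (cs * _)]card_ord -sum_nat_const; apply: leq_sum =>
    e _.
  rewrite exchange_big /=; apply: leq_trans sum_solve_cost; apply: leq_sum => v _.
  rewrite -big_distrl /= -[leqRHS]mul1n leq_mul2r; apply/orP; right.
  set c := class_size _ _ _; have [lt_m|ge_m] := ltnP c m.+1.
    rewrite (bigD1 (Ordinal lt_m)) //= eqxx big1 // => s; rewrite -val_eqE /= eq_sym.
    by move=> /negPf->.
  by rewrite big1 // => s _; rewrite gtn_eqF // (leq_trans (ltn_ord s)).
have stageE s : stage_cost k H psi s + 3 = ecost (ePow k) + 5 + (N * (ecost eM + 5) +
    \sum_(e < N) \sum_(v < m) (try_cost k H psi s e v + 3)).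
  rewrite /stage_cost -/N (eq_bigr (fun e : 'I_N => ecost eM + 5 +
    \sum_(v < m) (try_cost k H psi s e v + 3))); last by move=> e _; lia.
  by rewrite big_split /= sum_nat_const card_ord; lia.
have -> : search_cost k H psi = ecost eM1 + 2 + (m.+1 * (ecost (ePow k) + 5) +
    (m.+1 * (N * (ecost eM + 5)) +
     \sum_(s < m.+1) \sum_(e < N) \sum_(v < m) (try_cost k H psi s e v + 3))).
  rewrite /search_cost (eq_bigr (fun s : 'I_m.+1 =>
    ecost (ePow k) + 5 + (N * (ecost eM + 5) +
    \sum_(e < N) \sum_(v < m) (try_cost k H psi s e v + 3)))); last by move=> s _;
      apply: stageE.
  by rewrite !big_split /= !sum_nat_const !card_ord -[_ * _ + m.+1 * 5]mulnDr.
rewrite /search_const -/ct -/cs; set z := N * A ^ 2.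
have z_gt0 : 0 < z by rewrite muln_gt0 N_gt0 expn_gt0.
have NA_le : A * N <= z by rewrite /z (expnS A 1) expn1 mulnCA leq_mul2l leq_pmulr ?orbT.
have A_le : A <= z by apply: leq_trans NA_le; rewrite leq_pmulr.
apply: leq_addM; first exact: leq_constM.
apply: leq_addM; first by rewrite mulnC leq_mul2l (leq_trans _ A_le) ?orbT.
apply: leq_addM.
  rewrite mulnA mulnC leq_mul2l; apply/orP; right.
  by apply: leq_trans NA_le; rewrite leq_mul2r ltnS le_mn orbT.
apply: leq_trans sum_try _; apply: leq_addM; last by rewrite mulnCA.
rewrite [m * ct]mulnC [N * _]mulnCA [m.+1 * _]mulnCA leq_mul2l; apply/orP; right.
rewrite mulnCA leq_mul2l (expnS A 1) expn1; apply/orP; right.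
by apply: leq_mul => //; apply: leqW.
Qed.

End SearchCost.

Lemma total_cost_le k : 0 < k -> exists K,
  forall n m (H : sgraph 'I_m) (psi : 'I_n -> 'I_m),
  m <= n -> phase1_cost k n m + (search_cost k H psi + final_cost k m) <= K * n.+1 ^ (k +
    2).
Proof.
move=> k_gt0; have [K1 cc_le] := components_cost_le k.
pose c1 := ecost (ePow k) + 2;
  pose c2 := ecost (eNull k) + scost (CSet (Cst 0) 1) + (ecost eM + 2).
exists (c1 + 2 ^ k * (K1 + 3) + (search_const k * 2 ^ k + (c2 + (scost p_final + 3)))).
move=> n m H psi le_mn; set Z := n.+1 ^ (k + 2).
have Z_gt0 : 0 < Z by rewrite expn_gt0.
have A_le : n.+1 <= Z by rewrite -[leqLHS]expn1 leq_pexp2l // addn2.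
(* From [m <= n] the number of options is at most [2 * n.+1]. *)
have N_le : nopt n m ^ k * n.+1 ^ 2 <= 2 ^ k * Z.
  rewrite /Z expnD mulnA leq_mul2r -expnMn leq_exp2r // /nopt; apply/orP; right; lia.
have A2_gt0 : 0 < n.+1 ^ 2 by rewrite expn_gt0.
have mA : m <= n.+1 by apply: leqW.
have step : n.+1 ^ 2 <= n.+1 ^ k * n.+1 ^ 2 by rewrite leq_pmull // expn_gt0.
apply: leq_addM.
  rewrite /phase1_cost; apply: leq_addM; first exact: leq_constM.
  apply: leq_trans (_ : nopt n m ^ k * ((K1 + 3) * n.+1 ^ 2) <= _).
    rewrite leq_mul2l; apply/orP; right; apply: leq_addM; last exact: leq_constM.
    apply: leq_trans (cc_le m) _; rewrite leq_mul2l leq_exp2r // ltnS le_mn.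
    by rewrite orbT.
  by rewrite mulnCA -mulnA [leqRHS]mulnCA leq_mul2l N_le orbT.
apply: leq_addM.
  apply: leq_trans (search_cost_le k H psi le_mn) _.
  by rewrite -mulnA leq_mul2l N_le orbT.
have -> : final_cost k m = c2 + m * (scost p_final + 3) by rewrite /final_cost /c2; lia.
apply: leq_addM; last first.
  by rewrite mulnC leq_mul2l (leq_trans mA) ?orbT.
exact: leq_constM.
Qed.

Theorem lemma22 (k : nat) (k_gt0 : 0 < k) :
  exists (P : cmd) (b : nat) (T : nat -> nat),
    bigO T (fun n => n ^ (k + 2)) /\
    forall (n m : nat) (G : sgraph 'I_n) (H : sgraph 'I_m)
      (psi : 'I_n -> 'I_m),
      is_model G H psi -> treewidth_at_most H k ->
      exists (t : nat) (s : state),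
        [/\ exec (word_bound b n) P (init (encode G H psi)) t s,
            t <= T n
          & output s = count_independent_sets G].
Proof.
have [K K_le] := total_cost_le k_gt0.
pose none := fun _ : nat => 0.
(* Register 0 is never written and stands for all variables not in scope, with value 0 and degree 0.
   The exponent of the word bound is the degree of the program. *)
exists (compile none 1 (program k)), (sdeg none (program k)), (fun n => K * n.+1 ^ (k + 2)).
split.
  (* For [n >= 1], [n.+1] is at most [2 * n]. *)
  exists (K * 2 ^ (k + 2)), 1 => n n_gt0.
  by rewrite -mulnA -expnMn leq_mul2l leq_exp2r ?addn2 //; apply/orP; right; lia.
move=> n m G H psi [psi_onto psi_clique G_H] [td width_td].
have le_mn : m <= n.
  have [f fP] := fin_all_exists psi_onto.
  by have := leq_card f (can_inj fP); rewrite !card_ord.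
have leW : n.+2 ^ sdeg none (program k) <= word_bound (sdeg none (program k)) n.
  by rewrite /word_bound addn2.
have run := post_program le_mn leW G_H psi_clique width_td (r := none) (C := none).
have [|||||||t [s [x le_t _ _ out]]] := run none none 1 (init (encode G H psi)) => //.
  by move=> a; rewrite ltnS leqW // encode_le.
by exists t, s; split=> //; apply: leq_trans le_t (K_le _ _ _ _ le_mn).
Qed.
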